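(* Let $n > 1$ be an odd integer, let $k \in \mathbb{Z}$, and let $n = \prod_{i=1}^{t} p_i^{a_i}$ be the prime factorization of $n$ (with distinct primes $p_i$ and $a_i \ge 1$). Put $l = \lceil \frac{n+1}{2} \rceil$, $f_{n,k}(x_1,\dots,x_l) = \big(\sum_{i=1}^{l} x_i^n\big) - k$, and $N = \prod_{i=1}^{t} p_i^{a_i+1}$. Then $f_{n,k}$ is intersective if and only if the following is satisfied: (1) if $2n+1$ is not prime, then $f_{n,k} \equiv 0 \pmod{N}$ is solvable in integers $x_1,\dots,x_l$; (2) if $2n+1$ is prime, then $f_{n,k} \equiv 0 \pmod{(2n+1)N}$ is solvable in integers $x_1,\dots,x_l$.
   Context: The upper density of $T \subset \mathbb{Z}$ is $\overline{d}(T) = \limsup_{m\to\infty} \frac{|T \cap \{-m,\dots,m\}|}{2m+1}$. A set $S \subset \mathbb{Z}$ is intersective if for every $T \subset \mathbb{Z}$ with $\overline{d}(T) > 0$ one has $S \cap (T-T) \not\subseteq \{0\}$, where $T-T=\{t-t' : t,t'\in T\}$. A polynomial $f \in \mathbb{Z}[x_1,\dots,x_m]$ is intersective if its set of values $\{f(x_1,\dots,x_m) : x_1,\dots,x_m \in \mathbb{Z}\}$ is intersective. By a known result (Kamae and Mendès-France in one variable; Bergelson, Leibman and Lesigne in several variables), $f$ is intersective if and only if for every positive integer $M$ the congruence $f(x_1,\dots,x_m) \equiv 0 \pmod M$ has a solution in integers; the paper uses intersectivity in this form. *)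

(* Defs.v *)
From HB Require Import structures.
From mathcomp Require Import all_boot all_order all_algebra.
From mathcomp Require Import finmap zify.
From mathcomp Require Import all_classical all_reals all_analysis.
(* The notations of mpoly clash with those of mathcomp-analysis. *)
From mathcomp Require Import -(notations) mpoly.

Set Implicit Arguments.
Unset Strict Implicit.
Unset Printing Implicit Defensive.

Import Order.TTheory GRing.Theory Num.Theory.
Local Open Scope classical_set_scope.
Local Open Scope ring_scope.

Definition window (m : nat) : set int := [set i | - m%:Z <= i <= m%:Z].

(* [fset_set] is only meaningful on finite sets. *)
Lemma finite_window (m : nat) : finite_set (window m).
Proof.
apply: (@sub_finite_set _ _
  [set` [seq (j : nat)%:Z - m%:Z | j <- iota 0 (2 * m + 1)]]); last first.
  exact: finite_seq.
move=> i /= /andP[le_mi le_im]; apply/mapP; exists (absz (i + m%:Z)); last by lia.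
by rewrite mem_iota; lia.
Qed.

Definition upper_density (R : realType) (T : set int) : \bar R :=
  limn_esup (fun m : nat =>
    ((#|` fset_set (T `&` window m) |%fset)%:R / (2 * m + 1)%:R : R)%:E).

Definition difference_set (T : set int) : set int :=
  [set t - t' | t in T & t' in T].

Definition intersective_set (R : realType) (S : set int) : Prop :=
  forall T : set int, (0 < upper_density R T)%E ->
    ~ (S `&` difference_set T `<=` [set 0]).

Definition intersective_poly (R : realType) (m : nat) (f : mpoly m int) : Prop :=
  intersective_set R (range (fun x : 'I_m -> int => meval x f)).

Definition solvable_mod (m : nat) (f : mpoly m int) (M : nat) : Prop :=
  exists x : 'I_m -> int, (meval x f = 0 %[mod M%:Z])%Z.

(* [uphalf j] is the ceiling of [j / 2]. *)
Definition num_vars (n : nat) : nat := uphalf n.+1.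

Definition power_sum_poly (n : nat) (k : int) : mpoly (num_vars n) int :=
  (\sum_(i < num_vars n) mpolyX int (mnm1 i) ^+ n) - mpolyC _ k.

Lemma meval_power_sum_poly (n : nat) (k : int) (x : 'I_(num_vars n) -> int) :
  meval x (power_sum_poly n k) = (\sum_(i < num_vars n) x i ^+ n) - k.
Proof.
rewrite /power_sum_poly mevalB mevalC raddf_sum; congr (_ - _).
by apply: eq_bigr => i _ /=; rewrite rmorphXn /= mevalXU.
Qed.

(* Main.v *)
(* Locally, only a prime [p] not dividing [n] needs a new idea: every residue mod
   [p] must be a sum of [(n + 1) / 2] powers [x ^ n]. Let [H] be the group of
   nonzero [n]-th powers and [A = H U {0}], which is symmetric since [n] is odd.
   For [|H| > 2], Vosper's theorem for [A] holds in the form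
   [|X + A| > |X| + |H|] unless [X + A] is almost everything: a minimal set
   violating it (an atom, in Hamidoune's sense) meets its own images under
   [x |-> h x + t] in at most one point, which forces it to have two elements,
   and then [A] would be an arithmetic progression. Iterated sumsets therefore
   gain two [H]-cosets at each step. When [|H| = 2], [p - 1] divides [2 n] and
   only [p = 2 n + 1] is a true exception. Hensel lifting starts mod
   [p ^ (v_p(n) + 1)], and the Chinese remainder theorem concludes.

   Solvability modulo every [M] implies intersectivity: in a set [T] of positive
   upper density, an invariant mean turns [{poly R}] acting on the indicator of
   [T] by shifts into a stationary inner-product space with cyclic vector [1].
   Choose [M] such that the minimal norm in the convex hull of the ['X^j], [M | j],
   is almost maximal, and [u] almost minimal in that hull: then [u] is almost
   invariant under shifts by multiples of [M], and [1 - u] is almost killed by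
   averaging along any progression of step divisible by [M]. If [g] is a
   polynomial sequence with values divisible by [M], van der Corput's inequality
   reduces the mean of ['X^(g y) (1 - u)] to such averages, so the mean
   correlation of [T] with its translates by [g y] is about [<u, 1> > 0].
   Fixing all variables but one provides such a [g] among the values of [f]. *)
Require Import Defs.
From HB Require Import structures.
From mathcomp Require Import all_boot all_order all_algebra.
From mathcomp Require Import finmap zify ring lra finfield.

Set Implicit Arguments.
Unset Strict Implicit.
Unset Printing Implicit Defensive.

Import Order.TTheory GRing.Theory Num.Theory.

(** * Sums of powers in a prime field *)

Section Sumset.
Local Open Scope ring_scope.
Variables (p : nat) (p_pr : prime p).
Local Notation F := 'F_p.
Implicit Types X Y : {set F}.

Lemma card_Fp_p : #|[set: F]| = p.
Proof. by rewrite cardsT card_Fp. Qed.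

Lemma translation_invariant_full X (t x : F) :
  t != 0 -> x \in X -> (forall y, y \in X -> y + t \in X) -> X = [set: F].
Proof.
move=> t0 xX Xt; apply/setP => y; rewrite inE.
have step m : x + t *+ m \in X.
  by elim: m => [|m IH]; rewrite ?mulr0n ?addr0 // mulrSr addrA Xt.
have -> : y = x + t *+ ((y - x) / t : F); last by rewrite step.
rewrite -mulr_natr natr_Zp mulrC divfK //; ring.
Qed.

Definition sumset X Y : {set F} := [set x + y | x in X, y in Y].

Lemma sumsetP X Y z :
  reflect (exists x y, [/\ x \in X, y \in Y & z = x + y]) (z \in sumset X Y).
Proof.
apply: (iffP imset2P) => [[x y xX yY ->]|[x [y [xX yY ->]]]]; first by exists x, y.
by exists x y.
Qed.

Lemma mem_sumset X Y x y : x \in X -> y \in Y -> x + y \in sumset X Y.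
Proof. by move=> xX yY; apply/sumsetP; exists x, y. Qed.

Lemma sumsetS X X' Y : X \subset X' -> sumset X Y \subset sumset X' Y.
Proof. by move=> s; apply: imset2S. Qed.

Lemma sumsetU X X' Y : sumset (X :|: X') Y = sumset X Y :|: sumset X' Y.
Proof.
apply/setP => z; rewrite inE; apply/sumsetP/orP.
  move=> [x [y [/setUP[xX|xX] yY ->]]]; first by left; apply: mem_sumset.
  by right; apply: mem_sumset.
by case=> /sumsetP [x [y [xX yY ->]]]; exists x, y; rewrite inE xX ?orbT.
Qed.

End Sumset.

Lemma pair_inj (S T : Type) (x x' : S) (y y' : T) :
  (x, y) = (x', y') -> x = x' /\ y = y'.
Proof. by case. Qed.

(** * Vosper's inequality for a multiplicative subgroup with zero adjoined *)

Section SubgroupSumset.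
Local Open Scope ring_scope.
Variables (p : nat) (p_pr : prime p).
Local Notation F := 'F_p.
Variable H : {set F}.
Hypothesis H1 : 1 \in H.
Hypothesis HN : forall x, x \in H -> - x \in H.
Hypothesis HM : forall x y, x \in H -> y \in H -> x * y \in H.
Hypothesis HV : forall x, x \in H -> x^-1 \in H.
Hypothesis H0 : 0 \notin H.
Local Notation A := ([set (0 : F)] :|: H).
Local Notation s := #|H|.
Implicit Types X Y : {set F}.

Let A0 : 0 \in A. Proof. by rewrite !inE eqxx. Qed.
Let AN (a : F) : a \in A -> - a \in A.
Proof. by rewrite !inE oppr_eq0 => /orP[->//|/HN ->]; rewrite orbT. Qed.
Let AM (h a : F) : h \in H -> a \in A -> h * a \in A.
Proof.
move=> hH; rewrite !inE => /orP[/eqP->|aH]; first by rewrite mulr0 eqxx.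
by rewrite (HM hH aH) orbT.
Qed.
Let Hn0 (h : F) : h \in H -> h != 0. Proof. by apply: contraTneq => ->. Qed.
Let cardA : #|A| = s.+1. Proof. by rewrite cardsU1 H0. Qed.

Lemma sub_sumset X : X \subset sumset X A.
Proof. by apply/subsetP => x xX; rewrite -[x]addr0 mem_sumset. Qed.

Definition excess X := (#|sumset X A| - #|X|)%N.
(** The two bounds are exchanged by passing from [X] to the complement of [X + A], which lets that
    complement compete in [atom_meet]. *)
Definition admissible X := (2 <= #|X|)%N && (#|sumset X A| + 2 <= p)%N.
(** Lexicographic order, excess first and cardinality second, packed into one number: cardinalities
    stay below [p.+1]. *)
Definition size_key X := (excess X * p.+1 + #|X|)%N.
Definition atom X :=
  admissible X /\ (forall Y, admissible Y -> (size_key X <= size_key Y)%N).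

Let card_le_p X : (#|X| <= p)%N.
Proof. by rewrite -[X in (_ <= X)%N](card_Fp_p p_pr) subset_leq_card ?subsetT. Qed.

Lemma card_sumset X : #|sumset X A| = (excess X + #|X|)%N.
Proof. by rewrite /excess subnK // subset_leq_card // sub_sumset. Qed.

Lemma atom_le X Y : atom X -> admissible Y ->
  (excess X <= excess Y)%N /\ ((#|Y| < #|X|)%N -> (excess X < excess Y)%N).
Proof.
move=> [_ /(_ Y)] h /h; rewrite /size_key.
have := card_le_p X; have := card_le_p Y; move: (excess X) (excess Y) => e f.
move: #|X| #|Y| => x y; nia.
Qed.

Lemma atom_eq X Y : atom X -> atom Y -> excess X = excess Y /\ #|X| = #|Y|.
Proof.
move=> aX aY; have [h1 h2] := atom_le aX aY.1; have [h3 h4] := atom_le aY aX.1.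
lia.
Qed.

Lemma ex_atom X : admissible X -> exists2 Y, atom Y & (excess Y <= excess X)%N.
Proof.
move=> aX; case: (arg_minnP size_key aX) => Y aY mY; exists Y => //.
exact: (atom_le (conj aY mY) aX).1.
Qed.

Definition affine (h t x : F) := h * x + t.

Lemma affine_inj h t : h != 0 -> injective (affine h t).
Proof. by move=> h0 x y /addIr /(mulfI h0). Qed.

Lemma sumset_affine h t X : h \in H ->
  sumset (affine h t @: X) A = affine h t @: sumset X A.
Proof.
move=> hH; apply/setP => z; apply/sumsetP/imsetP.
  move=> [_ [a [/imsetP[x xX ->] aA ->]]]; exists (x + h^-1 * a).
    by rewrite mem_sumset // AM // HV.
  by rewrite /affine mulrDr mulrA divff ?Hn0 // mul1r addrAC.
move=> [_ /sumsetP[x [a [xX aA ->]]] ->]; exists (affine h t x), (h * a).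
by rewrite imset_f // AM // /affine; split=> //; ring.
Qed.

Lemma atom_affine h t X : h \in H -> atom X -> atom (affine h t @: X).
Proof.
move=> hH [aX mX]; have cX (Z : {set F}) : #|affine h t @: Z| = #|Z|.
  by rewrite card_imset //; apply/affine_inj/Hn0.
by split; rewrite /admissible /size_key /excess ?sumset_affine ?cX.
Qed.

(** Numerical core of [atom_meet]: [x, y, i, u, d] are the sizes of [X], [Y], their meet, their
    union and the complement of [X + A]; a trailing [a] marks the sumset with [A], a leading [e] the
    excess. The complement has the excess of [X], hence at least [x] elements, which leaves room for
    the union. *)
Lemma submodular_arith q x y i u d cx xa ya ia ua da eX eY eI eU eD :
  (i < x -> 1 < i -> xa + 2 <= q -> x = y -> u + i = x + y -> ua + ia <= xa + ya ->
   d + xa = q -> cx + x = q -> da <= cx -> eX = eY -> eX < eI -> eX <= eD ->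
   (d < x -> eX < eD) -> xa = eX + x -> ya = eY + y -> ia = eI + i ->
   ua = eU + u -> da = eD + d -> [/\ eU < eX, 1 < u & ua + 2 <= q])%N.
Proof. by move=> *; split; lia. Qed.

(* Submodularity of [X |-> #|X + A| - #|X|]; since [A = - A], the complement of
   [X + A] competes with [X], which keeps the union of two atoms small. *)
Lemma atom_meet X Y : atom X -> atom Y -> X != Y -> (#|X :&: Y| <= 1)%N.
Proof.
move=> aX aY nXY; rewrite leqNgt; apply/negP => I2.
have [eXY cXY] := atom_eq aX aY.
have /andP[X2 Xp] := aX.1.
pose I : {set F} := X :&: Y; pose U : {set F} := X :|: Y.
have ltI : (#|I| < #|X|)%N.
  rewrite proper_card // properEneq subsetIl andbT.
  apply: contraNneq nXY => /setIidPl sXY.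
  by rewrite eqEcard sXY cXY leqnn.
have sI : sumset I A \subset sumset X A :&: sumset Y A.
  by rewrite subsetI !sumsetS ?subsetIl ?subsetIr.
have aI : admissible I.
  rewrite /admissible I2 (leq_trans _ Xp) // leq_add2r subset_leq_card //.
  by rewrite sumsetS ?subsetIl.
have eI := (atom_le aX aI).2 ltI.
have cU : (#|U| + #|I| = #|X| + #|Y|)%N by rewrite cardsUI.
have leI : (#|sumset U A| + #|sumset I A| <= #|sumset X A| + #|sumset Y A|)%N.
  by rewrite -[leqRHS]cardsUI sumsetU leq_add2l subset_leq_card.
pose D : {set F} := ~: sumset X A.
have sD : sumset D A \subset ~: X.
  apply/subsetP => _ /sumsetP[d [a [dD aA ->]]]; rewrite inE.
  apply: contraTN dD => dX; rewrite inE negbK.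
  by rewrite -[d](addrK a) mem_sumset // AN.
have cD : (#|D| + #|sumset X A| = p)%N by rewrite addnC cardsC card_Fp.
have cC : (#|~: X| + #|X| = p)%N by rewrite addnC cardsC card_Fp.
have leD := subset_leq_card sD.
have aD : admissible D by rewrite /admissible; lia.
have [eD1 eD2] := atom_le aX aD.
have fX := card_sumset X; have fY := card_sumset Y; have fI := card_sumset I.
have fU := card_sumset U; have fD := card_sumset D.
have arith := submodular_arith ltI I2 Xp cXY cU leI cD cC leD eXY eI eD1 eD2 fX fY fI fU fD.
have aU : admissible U.
  by apply/andP; split; have [? []] := arith.
by have [] := atom_le aX aU; have [+ _] := arith; rewrite ltnNge => /negP.
Qed.

(** Counts the representations of [d] as a difference of two elements of [A]. *)
Definition shift_meet (d : F) := #|A :&: [set a + d | a in A]|.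

(* Scaling by [H] turns the pairs of [A] at distance [d] into [#|H|] times as
   many ordered pairs of [A] with difference in the coset [d H]. *)
Lemma shift_meet_cosets d e : d != 0 -> e != 0 -> e / d \notin H ->
  (shift_meet d + shift_meet e <= s.+1)%N.
Proof.
move=> d0 e0 ned.
pose P c := [set (x.1 * x.2, x.1 * (x.2 - c)) |
  x in setX H (A :&: [set a + c | a in A])].
have cP c : c != 0 -> #|P c| = (s * shift_meet c)%N.
  move=> c0; rewrite card_in_imset ?cardsX //.
  move=> [h a] [k b] /setXP[/= hH _] /setXP[/= kH _] /= eq_ab.
  have [e1 e2] := pair_inj eq_ab.
  have hk : h = k.
    apply: (mulIf c0); transitivity (h * a - h * (a - c)); first by ring.
    by rewrite e1 e2; ring.
  by move: e1; rewrite -hk => /(mulfI (Hn0 hH)) ->.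
have sP c : c != 0 -> P c \subset setX A A :\: [set (a, a) | a in A].
  move=> c0; apply/subsetP => _ /imsetP[[h a] /setXP[/= hH /setIP[aA /imsetP[b bA ab]]] ->].
  rewrite !inE; apply/and3P; split.
  - apply/imsetP => -[x _ eq_x]; have [e1 e2] := pair_inj eq_x.
    have : h * c = 0.
      by transitivity (h * a - h * (a - c)); [ring | rewrite e1 e2; ring].
    by move/eqP; rewrite mulf_eq0 (negPf (Hn0 hH)) (negPf c0).
  - by have := AM hH aA; rewrite !inE.
  - by have := AM hH bA; rewrite ab addrK !inE.
have dP : [disjoint P d & P e].
  rewrite -setI_eq0; apply/eqP/setP => z; rewrite !inE; apply/andP.
  move=> [/imsetP[[h a] /setXP[/= hH _] ->] /imsetP[[k b] /setXP[/= kH _] eq_ab]].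
  have [e1 e2] := pair_inj eq_ab.
  have hk : h * d = k * e.
    by transitivity (h * a - h * (a - d)); [ring | rewrite e1 e2; ring].
  move/negP: ned; apply; rewrite -[e](mulKf (Hn0 kH)) -hk !mulrA mulfK //.
  by rewrite HM // HV.
have := leq_card_setU (P d) (P e); have := cardsUI (P d) (P e).
rewrite (disjoint_setI0 dP) cards0 !cP // => cU _.
have : (#|P d :|: P e| <= #|setX A A :\: [set (a, a) | a in A]|)%N.
  by rewrite subset_leq_card // subUset !sP.
rewrite cardsD; set Q := setX A A :&: _.
have -> : Q = [set (a, a) | a in A].
  apply/setIidPr/subsetP => _ /imsetP[a aA ->]; exact/setXP.
rewrite card_imset; last by move=> x y [].
rewrite cardsX cardA.
have : (0 < s)%N by apply/card_gt0P; exists 1.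
move: (shift_meet d) (shift_meet e) cU; nia.
Qed.

Lemma shift_meet_ge X x y : x \in X -> y \in X ->
  (2 * s.+1 <= #|sumset X A| + shift_meet (x - y)%R)%N.
Proof.
move=> xX yX; set T := fun z : F => [set a + z | a in A].
have cT z : #|T z| = s.+1 by rewrite card_imset ?cardA //; apply: addIr.
have := cardsUI (T x) (T y).
have -> : #|T x :&: T y| = shift_meet (x - y).
  rewrite /shift_meet -[RHS](card_imset _ (@addIr _ y)); congr #|pred_of_set _|.
  apply/setP => z; apply/setIP/imsetP.
    move=> [/imsetP[a aA ->] /imsetP[b bA e]]; exists b => //.
    rewrite inE bA; apply/imsetP; exists a => //.
    by apply: (addIr y); rewrite -e; ring.
  move=> [b /setIP[bA /imsetP[a aA e]] ->]; split; last by apply: imset_f.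
  by apply/imsetP; exists a => //; rewrite e; ring.
rewrite !cT => e.
have : (#|T x :|: T y| <= #|sumset X A|)%N.
  rewrite subset_leq_card // subUset.
  by apply/andP; split; apply/subsetP => _ /imsetP[a aA ->]; rewrite addrC mem_sumset.
lia.
Qed.

Definition shift_loss (d : F) := #|A :\: [set a + d | a in A]|.

Lemma shift_loss_meet (d : F) : (shift_loss d + shift_meet d = s.+1)%N.
Proof. by rewrite addnC /shift_meet cardsID cardA. Qed.

(** An element of [A] outside [A + (d + e)] is either outside [A + d], or the shift by [d] of an
    element of [A] outside [A + e]. *)
Lemma shift_lossD (d e : F) :
  (shift_loss (d + e)%R <= shift_loss d + shift_loss e)%N.
Proof.
rewrite /shift_loss.
rewrite -[X in (_ <= _ + X)%N](card_imset _ (@addIr _ d)).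
apply: leq_trans (leq_card_setU _ _); apply: subset_leq_card.
apply/subsetP => x /setDP[xA xn]; rewrite !inE.
case: (boolP (x \in [set a + d | a in A])) => [/imsetP[a aA ea]|h] /=.
  apply/imsetP; exists a => //; rewrite inE aA andbT.
  apply: contra xn => /imsetP[b bA eb]; apply/imsetP; exists b => //.
  by rewrite ea eb; ring.
by move: xA; rewrite !inE => ->.
Qed.

Lemma shift_meet_scale h d : h \in H -> shift_meet (h * d) = shift_meet d.
Proof.
move=> hH; rewrite /shift_meet -[RHS](card_imset _ (mulfI (Hn0 hH))).
congr #|pred_of_set _|; apply/setP => z; apply/setIP/imsetP.
  move=> [zA /imsetP[a aA ea]]; exists (h^-1 * z); last by rewrite mulrA divff ?Hn0 ?mul1r.
  rewrite inE AM ?HV //=; apply/imsetP; exists (h^-1 * a); first by rewrite AM ?HV.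
  by rewrite ea mulrDr mulrA mulVf ?Hn0 ?mul1r.
move=> [x /setIP[xA /imsetP[a aA ea]] ->]; rewrite AM //; split=> //.
by apply/imsetP; exists (h * a); rewrite ?AM // ea mulrDr.
Qed.



Lemma atom_eq2 X Y x y : atom X -> atom Y -> x != y ->
  x \in X -> y \in X -> x \in Y -> y \in Y -> X = Y.
Proof.
move=> aX aY nxy xX yX xY yY; apply/eqP; apply: contraT => nXY.
have := atom_meet aX aY nXY; rewrite leqNgt => /negP[].
by apply/card_gt1P; exists x, y; rewrite !inE xX yX xY yY.
Qed.

Lemma admissible_neqT X : admissible X -> X <> [set: F].
Proof.
move=> /andP[_ Xp] XT; have := subset_leq_card (sub_sumset X).
rewrite {1}XT cardsT card_Fp //; move: Xp; case: #|_| => [|c]; lia.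
Qed.

(** One quotient gives an affine map fixing [x] and sending [y] to [z], the other a map fixing [y]
    and sending [x] to [z]. Each image of [X] shares two points with [X], hence equals it. Composed
    in either order the maps differ by a nonzero translation, which then preserves [X]. *)
Lemma atom_no_triple X x y z : atom X -> x \in X -> y \in X -> z \in X ->
  x != y -> y != z -> z != x ->
  (z - x) / (y - x) \in H -> (z - y) / (x - y) \in H -> False.
Proof.
move=> aX xX yX zX nxy nyz nzx; set h := _ / _; set k := _ / _ => hH kH.
have yx0 : y - x != 0 by rewrite subr_eq0 eq_sym.
have xy0 : x - y != 0 by rewrite subr_eq0.
have hE : h * (y - x) = z - x by rewrite divfK.
have kE : k * (x - y) = z - y by rewrite divfK.
have hX : affine h (x - h * x) @: X = X.
  apply: (atom_eq2 _ aX nzx) => //; first exact: atom_affine.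
    by apply/imsetP; exists y => //; rewrite /affine -(subrK x z) -hE; ring.
  by apply/imsetP; exists x => //; rewrite /affine; ring.
have kX : affine k (y - k * y) @: X = X.
  apply: (atom_eq2 _ aX nyz) => //; first exact: atom_affine.
    by apply/imsetP; exists y => //; rewrite /affine; ring.
  by apply/imsetP; exists x => //; rewrite /affine -(subrK y z) -kE; ring.
have mh u : u \in X -> affine h (x - h * x) u \in X by move=> uX; rewrite -hX imset_f.
have mk u : u \in X -> affine k (y - k * y) u \in X by move=> uX; rewrite -kX imset_f.
apply: (admissible_neqT aX.1).
apply: (@translation_invariant_full _ _ ((1 - h) * (1 - k) * (x - y)) x) => //.
  rewrite !mulf_neq0 // subr_eq0.
    apply: contraNneq nyz => h1; move: hE; rewrite -h1 mul1r => /addIr ->.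
    exact: eqxx.
  apply: contraNneq nzx => k1; move: kE; rewrite -k1 mul1r => /addIr ->.
  exact: eqxx.
move=> w; rewrite -{1}kX => /imsetP[v]; rewrite -{1}hX => /imsetP[u uX ->] ->.
have := mh _ (mk _ uX); rewrite /affine; congr (_ \in X); ring.
Qed.

(** The translates of [X] by [0], [1] and [-1] lie in [X + A] and pairwise share at most one
    point. *)
Lemma atom_translates X : atom X -> 1 != -1 :> F ->
  (3 * #|X| <= #|sumset X A| + 3)%N.
Proof.
move=> aX n11; set T := fun t : F => affine 1 t @: X.
have aT t : atom (T t) by apply: atom_affine.
have nT t u : t != u -> T t != T u.
  move=> ntu; apply/eqP => eT; apply: (admissible_neqT (aT u).1).
  have /andP[X2 _] := aX.1; have /card_gt0P[x xX] : (0 < #|X|)%N by lia.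
  apply: (@translation_invariant_full _ _ (t - u) (affine 1 u x)).
  - by rewrite subr_eq0.
  - exact: imset_f.
  move=> y /imsetP[v vX ->]; rewrite -eT; apply/imsetP; exists v => //.
  by rewrite /affine; ring.
have cT t : #|T t| = #|X| by rewrite card_imset //; apply/affine_inj/oner_neq0.
have sT t : t \in A -> T t \subset sumset X A.
  by move=> tA; apply/subsetP => _ /imsetP[x xX ->]; rewrite /affine mul1r mem_sumset.
have n01 : 0 != 1 :> F by rewrite eq_sym oner_neq0.
have n0N1 : 0 != -1 :> F by rewrite eq_sym oppr_eq0 oner_neq0.
have m01 := atom_meet (aT 0) (aT 1) (nT _ _ n01).
have m02 := atom_meet (aT 0) (aT (-1)) (nT _ _ n0N1).
have m12 := atom_meet (aT 1) (aT (-1)) (nT _ _ n11).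
have u1 := cardsUI (T 0) (T 1).
have u2 := cardsUI (T 0%R :|: T 1%R) (T (-1)).
have u3 : (#|(T 0%R :|: T 1%R) :&: T (-1)%R| <= #|T 0%R :&: T (-1)%R| + #|T 1%R :&: T (-1)%R|)%N.
  by rewrite setIUl leq_card_setU.
have u4 : (#|T 0%R :|: T 1%R :|: T (-1)%R| <= #|sumset X A|)%N.
  by rewrite subset_leq_card // !subUset !sT // !inE ?eqxx ?H1 ?HN ?orbT.
rewrite !cT in u1 u2.
by move: m01 m02 m12 u1 u2 u3 u4; do !move: #|_|; clear; lia.
Qed.

(** By [atom_no_triple], two differences of three points lie in different cosets of [H], so
    [2 |X + A| >= 3 (s + 1)] by [shift_meet_cosets]. With excess at most [s], [atom_translates]
    gives [2 |X| <= s + 3], so [2 |X + A| <= 3 (s + 1)]. Equality is impossible for even [s]. *)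
Lemma atom_large X : atom X -> ~~ odd s -> 1 != -1 :> F -> (3 <= #|X|)%N ->
  (s < excess X)%N.
Proof.
move=> aX evs n11 X3; rewrite ltnNge; apply/negP => eX.
have /card_gt2P[x [y [z [[xX yX zX] [nxy nyz nzx]]]]] := X3.
have [d [e [d0 e0 ned dX eX']]] : exists d e, [/\ d != 0, e != 0, e / d \notin H,
    (2 * s.+1 <= #|sumset X A| + shift_meet d)%N &
    (2 * s.+1 <= #|sumset X A| + shift_meet e)%N].
  have [h1|h1] := boolP ((z - x) / (y - x) \in H); last first.
    by exists (y - x), (z - x); rewrite !subr_eq0 eq_sym nxy nzx h1 !shift_meet_ge.
  have [h2|h2] := boolP ((z - y) / (x - y) \in H).
    by case: (atom_no_triple aX xX yX zX nxy nyz nzx h1 h2).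
  by exists (x - y), (z - y); rewrite !subr_eq0 nxy eq_sym nyz h2 !shift_meet_ge.
have := shift_meet_cosets d0 e0 ned; have := atom_translates aX n11.
move: dX eX' X3 evs eX; rewrite card_sumset.
move: (shift_meet d) (shift_meet e) (excess X); clear; do !move: #|_|; lia.
Qed.

(** With excess at most [s], [A] loses at most one element under the shift by the difference [d] of
    the two points. Loss is subadditive and invariant under [H], so for [j] in [H] the shift by
    [(j + 1) d] loses at most two; as [s >= 3], this puts [j + 1] in [A]. By induction [A] is the
    whole field. *)
Lemma atom_pair X : atom X -> (3 <= s)%N -> #|X| = 2 -> (s < excess X)%N.
Proof.
move=> aX s3 X2; rewrite ltnNge; apply/negP => eX.
have /card_gt1P[x [y [xX yX nxy]]] : (1 < #|X|)%N by rewrite X2.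
set d := x - y; have d0 : d != 0 by rewrite subr_eq0.
have Rd : (s <= shift_meet d)%N.
  have := shift_meet_ge xX yX; rewrite card_sumset X2 -/d; move: eX.
  by move: (shift_meet d) (excess X) => r f; lia.
have natA j : (j%:R : F) \in A.
  elim: j => [|j IH]; first exact: A0.
  case: (boolP ((j.+1)%:R \in A)) => // jA.
  have [j0|j0] := eqVneq (j%:R : F) 0.
    by move: jA; rewrite -natr1 j0 add0r !inE H1 orbT.
  have jH : j%:R \in H by move: IH; rewrite !inE (negPf j0).
  have Rj : shift_meet (j%:R * d) = shift_meet d by exact: shift_meet_scale.
  have l1 := shift_loss_meet d; have lj := shift_loss_meet (j%:R * d).
  have lS := shift_loss_meet (j.+1%:R * d).
  have := shift_lossD (j%:R * d) d.
  rewrite -{1 2}[d]mul1r -[X in _ + X * _]/(1%:R) mulrA mulr1 -mulrDl natr1.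
  move: jA; rewrite !inE negb_or => /andP[Sj0 SjH].
  have := @shift_meet_cosets d (j.+1%:R * d) d0; rewrite mulf_neq0 // mulfK //.
  move=> /(_ isT SjH).
  rewrite Rj in lj; move: l1 lj lS Rd s3.
  move: (shift_meet d) (shift_meet _) (shift_loss d) (shift_loss _) (shift_loss _).
  by clear; lia.
have /andP[_] := aX.1; have -> : sumset X A = [set: F].
  apply/setP => w; rewrite inE -(subrK x w) addrC mem_sumset //.
  by rewrite -[w - x]natr_Zp natA.
by rewrite cardsT card_Fp //; lia.
Qed.

Lemma sumset_expand X : ~~ odd s -> (3 <= s)%N -> 1 != -1 :> F -> (2 <= #|X|)%N ->
  (#|sumset X A| + 2 <= p)%N -> (#|X| + s < #|sumset X A|)%N.
Proof.
move=> evs s3 n11 X2 Xp.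
have [|Y aY] := @ex_atom X; first by rewrite /admissible X2 Xp.
rewrite card_sumset addnC ltn_add2r; apply: leq_trans.
have /andP[] := aY.1; rewrite leq_eqVlt => /orP[/eqP Y2 _|Y3 _].
  exact: atom_pair.
exact: atom_large.
Qed.



Definition H_stable X := forall h x, h \in H -> x \in X -> h * x \in X.

Lemma H_stable_dvd X : 0 \notin X -> H_stable X -> (s %| #|X|)%N.
Proof.
have [m] := ubnP #|X|; elim: m X => // m IH X /ltnSE leX X0 stX.
have [->|[x xX]] := set_0Vmem X; first by rewrite cards0 dvdn0.
have x0 : x != 0 by apply: contraNneq X0 => <-.
pose O : {set F} := [set h * x | h in H].
have cO : #|O| = s by rewrite card_imset //; apply: mulIf.
have sO : O \subset X by apply/subsetP => _ /imsetP[h hH ->]; apply: stX.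
have s0 : (0 < s)%N by apply/card_gt0P; exists 1.
have cXO : (#|X :\: O| + s = #|X|)%N by rewrite -cO cardsDS // subnK ?subset_leq_card.
rewrite -cXO dvdn_addl //; apply: IH; first by lia.
  by rewrite inE negb_and X0 orbT.
move=> h y hH /setDP[yX yO]; rewrite inE stX // andbT.
apply: contra yO => /imsetP[k kH e]; apply/imsetP; exists (h^-1 * k).
  by rewrite HM ?HV.
by rewrite -mulrA -e mulKf // Hn0.
Qed.

Lemma H_stable_card X : 0 \in X -> H_stable X -> exists c, #|X| = (1 + c * s)%N.
Proof.
move=> X0 stX; have /dvdnP[c e] : (s %| #|X :\ 0%R|)%N.
  apply: H_stable_dvd; first by rewrite !inE eqxx.
  move=> h x hH /setD1P[x0 xX]; rewrite in_setD1 stX // andbT.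
  by rewrite mulf_neq0 // Hn0.
by exists c; rewrite (cardsD1 0) X0 e.
Qed.

Definition nfold m := iter m (fun X => sumset X A) [set 0].

Lemma nfold_stable m : 0 \in nfold m /\ H_stable (nfold m).
Proof.
elim: m => [|m [IH0 IHs]]; first by split=> [|h x hH]; rewrite !inE // => /eqP ->; rewrite mulr0.
split; first by rewrite -[0]addr0 mem_sumset.
move=> h x hH /sumsetP[y [a [yX aA ->]]]; rewrite mulrDr mem_sumset ?AM //.
exact: IHs.
Qed.

(** Both [|X|] and [p] are [1] modulo [s], so a gap of at most one must vanish when [s > 1]. *)
Let card_eqT X : 0 \in X -> H_stable X -> (1 < s)%N -> (p <= #|X| + 1)%N -> X = [set: F].
Proof.
move=> X0 stX s1 Xp; have [c cX] := H_stable_card X0 stX.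
have [|d] := @H_stable_card [set: F] (in_setT _); first by move=> *; rewrite inE.
rewrite cardsT card_Fp // => dp; apply/eqP.
rewrite eqEcard subsetT cardsT card_Fp //=; move: Xp; rewrite cX.
move: (#|H|) s1 dp => q q1 dp pc; suff : (d <= c)%N.
  by move=> dc; rewrite dp leq_add2l leq_mul2r dc orbT.
by rewrite leqNgt; apply/negP => cd; nia.
Qed.

(** Sizes are [1] modulo [s], so any growth is by at least [s]; a set that stops growing is
    invariant under adding [1] and hence full. *)
Lemma nfold_growth m : (1 < s)%N ->
  nfold m = [set: F] \/ (1 + s * m <= #|nfold m|)%N.
Proof.
move=> s1; elim: m => [|m IH]; first by right; rewrite /= cards1; lia.
have [X0 stX] := nfold_stable m; have [Y0 stY] := nfold_stable m.+1.
have [c cX] := H_stable_card X0 stX; have [d cY] := H_stable_card Y0 stY.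
have sXY : nfold m \subset nfold m.+1 by apply: sub_sumset.
case: IH => [XT|IH]; first by left; apply/eqP; rewrite eqEsubset subsetT -XT.
have [/eqP eXY|nXY] := boolP (nfold m == nfold m.+1).
  left; rewrite -eXY; apply: (@translation_invariant_full _ _ 1 0) => // y yX.
  by rewrite eXY mem_sumset // !inE H1 orbT.
right; have : (#|nfold m| < #|nfold m.+1|)%N.
  by rewrite proper_card // properEneq nXY sXY.
move: IH; rewrite cX cY !ltn_add2l ltn_mul2r => IH /andP[_ cd]; nia.
Qed.

(** Growth by more than [s] is growth by at least [2 s], since sizes are [1] modulo [s]. The first
    step, from a single point, only yields [s]. *)
Lemma nfold_fast_growth m : (2 < s)%N -> ~~ odd s -> 1 != -1 :> F ->
  nfold m.+1 = [set: F] \/ (1 + s * (2 * m + 1) <= #|nfold m.+1|)%N.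
Proof.
move=> s2 evs n11; have s1 := ltnW s2; elim: m => [|m IH].
  by have := nfold_growth 1 s1; rewrite muln1.
have [X0 stX] := nfold_stable m.+1; have [Y0 stY] := nfold_stable m.+2.
have [c cX] := H_stable_card X0 stX; have [d cY] := H_stable_card Y0 stY.
have sXY : nfold m.+1 \subset nfold m.+2 by apply: sub_sumset.
case: IH => [XT|IH]; first by left; apply/eqP; rewrite eqEsubset subsetT -XT.
have [pY|pY] := leqP p (#|nfold m.+2| + 1); first by left; apply: card_eqT.
right; have : (#|nfold m.+1| + s < #|nfold m.+2|)%N.
  apply: sumset_expand => //; last by rewrite addn2 -addn1.
  by apply: leq_trans IH; rewrite add1n ltnS muln_gt0 (ltnW s1) addn1.
move: IH; rewrite cX cY leq_add2l mulnC leq_pmul2r ?(ltnW s1) // => IH.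
rewrite -addnA ltn_add2l -mulSnr ltn_pmul2r ?(ltnW s1) // => cd.
rewrite leq_add2l mulnC leq_pmul2r ?(ltnW s1) //; lia.
Qed.

(** Negation permutes [H], so the nonzero product of its elements is multiplied by [(-1) ^ s] and
    yet unchanged. *)
Lemma subgroup_card_even : 1 != -1 :> F -> ~~ odd s.
Proof.
move=> n11; apply: contra n11 => os; apply/eqP.
have P0 : \prod_(h in H) h != 0 by apply/prodf_neq0 => h; apply: Hn0.
apply: (mulIf P0); rewrite mul1r.
rewrite [LHS](reindex_inj (@oppr_inj F)) [LHS](eq_bigl (fun h => h \in H)); last first.
  by move=> h; apply/idP/idP => /HN; rewrite ?opprK.
by rewrite prodrN -signr_odd os.
Qed.

End SubgroupSumset.

Section PowerSums.
Local Open Scope ring_scope.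
Variables (p : nat) (p_pr : prime p) (n : nat).
Hypotheses (n_odd : odd n) (n_gt1 : (1 < n)%N).
Local Notation F := 'F_p.

Definition power_residues : {set F} := [set x ^+ n | x in [set~ (0 : F)]].
Local Notation H := power_residues.

Lemma power_residues1 : 1 \in H.
Proof. by apply/imsetP; exists 1; rewrite ?inE ?oner_neq0 ?expr1n. Qed.

Lemma power_residuesN x : x \in H -> - x \in H.
Proof.
move=> /imsetP[y]; rewrite !inE => y0 ->; apply/imsetP; exists (- y).
  by rewrite !inE oppr_eq0.
by rewrite exprNn -signr_odd n_odd expr1 mulN1r.
Qed.

Lemma power_residuesM x y : x \in H -> y \in H -> x * y \in H.
Proof.
move=> /imsetP[a]; rewrite !inE => a0 -> /imsetP[b]; rewrite !inE => b0 ->.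
by apply/imsetP; exists (a * b); rewrite ?inE ?mulf_neq0 // exprMn.
Qed.

Lemma power_residuesV x : x \in H -> x^-1 \in H.
Proof.
move=> /imsetP[a]; rewrite !inE => a0 ->.
by apply/imsetP; exists a^-1; rewrite ?inE ?invr_eq0 // exprVn.
Qed.

Lemma power_residues0 : 0 \notin H.
Proof.
apply/imsetP => -[a]; rewrite !inE => a0 /esym/eqP; rewrite expf_eq0.
by rewrite (negPf a0) andbF.
Qed.

Lemma nfold_power_residues m c : c \in nfold H m ->
  exists x : 'I_m -> F, \sum_i x i ^+ n = c.
Proof.
elim: m c => [|m IH] c; first by rewrite inE => /eqP ->; exists (fun _ => 0); rewrite big_ord0.
move=> /sumsetP[y [a [/IH[x <-] aA ->]]].
have [b ->] : exists b, a = b ^+ n.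
  move: aA; rewrite !inE => /orP[/eqP ->|/imsetP[b _ ->]]; last by exists b.
  by exists 0; rewrite expr0n; case: (n) n_gt1.
exists (fun i => if unlift ord_max i is Some j then x j else b).
rewrite big_ord_recr /= unlift_none; congr (_ + _); apply: eq_bigr => i _.
have -> : widen_ord (leqnSn m) i = lift ord_max i.
  by apply: val_inj; rewrite /= /bump leqNgt ltn_ord.
by rewrite liftK.
Qed.

Lemma card_power_residues : (p <= 1 + #|H| * n)%N.
Proof.
have pE : (1 + #|[set~ (0%R : F)]|)%N = p.
  by rewrite cardsC1 card_Fp // add1n prednK ?prime_gt0.
rewrite -[leqLHS]pE leq_add2l -sum1_card.
rewrite (partition_big (fun x : F => x ^+ n) (mem H)) /=; last by move=> x xF; apply: imset_f.
rewrite -sum_nat_const; apply: leq_sum => h _; rewrite sum1_card.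
have n0 : (0 < n)%N by apply: ltnW.
have := @max_poly_roots F ('X^n - h%:P) (enum [pred x : F | (x \in [set~ 0]) && (x ^+ n == h)]).
rewrite -size_poly_eq0 size_XnsubC // -cardE => /(_ isT) mp; rewrite -ltnS; apply: mp.
  apply/allP => x; rewrite mem_enum !inE => /andP[_ /eqP e].
  by rewrite /root !hornerE e subrr.
by rewrite enum_uniq.
Qed.



Lemma nonzero_roots_bound r : (0 < r)%N -> (forall x : F, x != 0 -> x ^+ r = 1) ->
  (p <= r.+1)%N.
Proof.
move=> r0 xr; have := @max_poly_roots F ('X^r - 1%:P) (enum [set~ (0 : F)]).
rewrite -size_poly_eq0 size_XnsubC // -cardE => /(_ isT).
have -> : #|[set~ (0 : F)]| = p.-1 by rewrite cardsC1 card_Fp.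
rewrite enum_uniq => h; have : (p.-1 < r.+1)%N; last by lia.
apply: h => //; apply/allP => x; rewrite mem_enum !inE => x0.
by rewrite /root !hornerE xr // subrr.
Qed.

(** Here [H] is [{1, -1}], so every nonzero [x] has [x ^ (2 n) = 1]. A nonzero remainder of [2 n] by
    [p - 1] would inherit this, with too small a degree for [p - 1] roots. *)
Lemma two_power_residues : #|H| = 2 -> 1 != -1 :> F -> (p.-1 %| 2 * n)%N.
Proof.
move=> cH n11; have HE : H = [set 1; -1].
  apply/esym/eqP; rewrite eqEcard cH cards2 n11 andbT subUset !sub1set.
  by rewrite power_residues1 power_residuesN ?power_residues1.
have x2n (x : F) : x != 0 -> x ^+ (2 * n) = 1.
  move=> x0; have : x ^+ n \in H by apply: imset_f; rewrite !inE.
  by rewrite mulnC exprM HE !inE => /orP[]/eqP ->; rewrite ?sqrrN expr1n.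
have xp (x : F) : x != 0 -> x ^+ p.-1 = 1.
  move=> x0; apply: (mulfI x0); rewrite -exprS prednK ?prime_gt0 // mulr1.
  by have := expf_card x; rewrite card_Fp.
have p1 := prime_gt1 p_pr.
rewrite /dvdn; have [//|r0] := posnP (2 * n %% p.-1).
have := @nonzero_roots_bound _ r0; rewrite leqNgt => h.
have : (2 * n %% p.-1 < p.-1)%N by rewrite ltn_mod; lia.
suff: ~~ ((2 * n %% p.-1).+1 < p)%N by lia.
apply: h => x x0; have := x2n x x0.
by rewrite {1}(divn_eq (2 * n) p.-1) exprD mulnC exprM xp // expr1n mul1r.
Qed.

Lemma every_residue_power_sum l (c : F) : n.+1 = (2 * l)%N -> p <> (2 * n + 1)%N ->
  exists x : 'I_l -> F, \sum_i x i ^+ n = c.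
Proof.
move=> nl np; apply: nfold_power_residues.
have H1 := power_residues1; have HN := power_residuesN; have HM := power_residuesM.
have HV := power_residuesV; have H0 := power_residues0.
suff -> : nfold H l = [set: F] by rewrite inE.
have full (X : {set F}) : (p <= #|X|)%N -> X = [set: F].
  by move=> pX; apply/eqP; rewrite eqEcard subsetT cardsT card_Fp.
have pH := card_power_residues.
have [n11|n11] := eqVneq (1 : F) (-1).
  have p2 : (p <= 2)%N.
    apply: dvdn_leq => //; rewrite (dvdn_pcharf (pchar_Fp p_pr)).
    have -> : 2%:R = 1 + 1 :> F by [].
    by rewrite {1}n11 addNr.
  have AT : 0 |: H = [set: F].
    apply: full; rewrite cardsU1 H0 (leq_trans p2) // add1n ltnS.
    by apply/card_gt0P; exists 1.
  case: l nl => [|l] nl; first by lia.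
  have [X0 _] := nfold_stable HM l.
  by apply/setP => y; rewrite inE -[y]add0r mem_sumset // AT inE.
have evs := subgroup_card_even HN H0 n11.
have s0 : (0 < #|H|)%N by apply/card_gt0P; exists 1.
have [s3|s2] := leqP 3 #|H|.
  case: l nl => [|l] nl; first by lia.
  (* For [(n + 1) / 2] summands the lower bound is [1 + s n], which is at least [p] by
     [card_power_residues]. *)
  have [//|h] := nfold_fast_growth p_pr H1 HN HM HV H0 l s3 evs n11.
  by apply: full; apply: leq_trans pH (leq_trans _ h); rewrite leq_add2l leq_mul2l; lia.
have sE : #|H| = 2 by lia.
have [|//|h] := nfold_growth p_pr H1 HM HV H0 l; first by rewrite sE.
apply: full; apply: leq_trans h; rewrite sE.
have p1 := prime_gt1 p_pr.
(* Write [2 n = e (p - 1)]: [e = 1] is the excluded [p = 2 n + 1], and [e >= 2] gives [p <= n + 1],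
   below the bound [1 + 2 l = n + 2] already reached. *)
have /dvdnP[e he] := two_power_residues sE n11.
have [e0|[e1|e2]] : e = 0%N \/ e = 1%N \/ (2 <= e)%N by lia.
- by move: he; rewrite e0; lia.
- by move: he; rewrite e1; lia.
have : (2 * p.-1 <= 2 * n)%N by rewrite he leq_mul2r e2 orbT.
by lia.
Qed.

End PowerSums.

(** * Lifting and gluing congruences *)

Section Hensel.
Local Open Scope ring_scope.

(* The binomial coefficient [C(n, j)] loses at most [v_p(j)] factors [p] of [n],
   and [v_p(j) + 2 <= j] for [j >= 2]; the case [j = p = 2] has to be excluded. *)
Lemma binomial_term_dvd p a r n j : prime p -> (a == 0)%N || odd p ->
  (p ^ a %| n)%N -> (0 < r)%N -> (2 <= j)%N ->
  (p ^ (a + r).+1 %| 'C(n, j) * p ^ (r * j))%N.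
Proof.
move=> p_pr ap pn r0 j2.
have [/eqP a0|a0] := boolP (a == 0%N).
  by rewrite dvdn_mull // dvdn_exp2l // a0; nia.
have op : odd p by move: ap; rewrite (negPf a0).
have p3 : (3 <= p)%N by have := prime_gt1 p_pr; case: p op {pn p_pr ap} => [|[|[|p]]].
have j0 : (0 < j)%N by lia.
have [m j_m pj] : exists2 m, (j = m * p ^ logn p j)%N & coprime p m.
  exists (j %/ p ^ logn p j)%N; first by rewrite divnK // pfactor_dvdnn.
  by have [m mj je] := pfactor_coprime p_pr j0; rewrite {1}je mulnK // expn_gt0 prime_gt0.
set v := logn p j in j_m.
have vj : (3 ^ v <= j)%N.
  rewrite j_m -[X in (X <= _)%N]mul1n leq_mul //.
    by rewrite lt0n; apply: contraTneq j0 => m0; rewrite j_m m0.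
  by case: (v) => // w; rewrite leq_exp2r.
have vj2 : (v + 2 <= j)%N.
  case: v vj {j_m} => [|v] // h; apply: leq_trans h.
  elim: v => // v IH; rewrite expnS; lia.
have : (p ^ a %| p ^ v * 'C(n, j))%N.
  have : (p ^ a %| m * (p ^ v * 'C(n, j)))%N.
    rewrite mulnA -j_m; case: j j0 {j2 j_m vj vj2 v pj} => // j _.
    case: n pn => [|n] pn; first by rewrite bin0n muln0.
    by rewrite -mul_bin_diag dvdn_mulr.
  by rewrite Gauss_dvdr // coprimeXl.
case: (leqP v a) => va; last first.
  by move=> _; rewrite dvdn_mull // dvdn_exp2l //; nia.
rewrite -{1}(subnKC va) expnD dvdn_pmul2l ?expn_gt0 ?prime_gt0 // => h.
have -> : ((a + r).+1 = (a - v) + (v + r).+1)%N by lia.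
by rewrite expnD dvdn_mul // dvdn_exp2l //; nia.
Qed.

Lemma power_step_expansion p a r n (y z : int) : prime p -> (a == 0)%N || odd p ->
  (p ^ a %| n)%N -> (0 < r)%N -> (0 < n)%N ->
  ((y + p%:Z ^+ r * z) ^+ n = y ^+ n + (n * p ^ r)%:Z * y ^+ n.-1 * z
     %[mod (p ^ (a + r).+1)%:Z])%Z.
Proof.
move=> p_pr ap pn r0 n0; apply/eqP; rewrite eqz_mod_dvd exprDn.
rewrite -(ltn_predK n0) big_ord_recl big_ord_recl /=.
rewrite bin0 subn0 expr0 mulr1 mulr1n /bump /= add1n bin1 expr1 subn1 /=.
set S := \sum_(i < _) _.
have -> : y ^+ n.-1.+1 + (y ^+ n.-1 * (p%:Z ^+ r * z) *+ n.-1.+1 + S) -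
  (y ^+ n.-1.+1 + (n.-1.+1 * p ^ r)%:Z * y ^+ n.-1 * z) = S.
  by rewrite PoszM -mulr_natr -(rmorphXn Posz) /= natz; ring.
apply: rpred_sum => i _; rewrite exprMn -exprM /= !add1n.
set t := y ^+ _; set w := z ^+ _.
have -> : t * (p%:Z ^+ (r * i.+2) * w) *+ 'C(n.-1.+1, i.+2) =
  t * w * ('C(n.-1.+1, i.+2) * p ^ (r * i.+2))%N%:Z.
  by rewrite PoszM -mulr_natr -(rmorphXn Posz) /= natz; ring.
rewrite dvdz_mull // dvdzE /= binomial_term_dvd // prednK //.
Qed.

Lemma linear_congruence p (b c : int) : prime p -> ~~ (p%:Z %| b)%Z ->
  exists z, (p%:Z %| b * z - c)%Z.
Proof.
move=> p_pr pb.
have : coprimez b p%:Z by rewrite coprimez_sym coprimezE /= prime_coprime // -dvdzE.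
move=> /coprimezP[[u v] /= e]; exists (u * c).
have -> : b * (u * c) - c = (- v * c) * p%:Z.
  transitivity ((u * b) * c - c); first by ring.
  have -> : u * b = 1 - v * p%:Z by rewrite -e; ring.
  by ring.
by rewrite dvdz_mull.
Qed.

(** Changing [y] by [p ^ r z] moves [y ^ n] by [n p ^ r y ^ (n - 1) z], whose coefficient at [z] has
    valuation exactly [a + r]; so [z] has only to solve a linear congruence modulo [p]. *)
Lemma hensel_power_step p a r n (u y : int) : prime p -> (a == 0)%N || odd p ->
  (0 < n)%N -> a = logn p n -> (0 < r)%N -> ~~ (p%:Z %| y)%Z ->
  ((p ^ (a + r))%:Z %| y ^+ n - u)%Z ->
  exists2 y', ~~ (p%:Z %| y')%Z & ((p ^ (a + r).+1)%:Z %| y' ^+ n - u)%Z.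
Proof.
move=> p_pr ap n0 ea r0 py /dvdzP[w hw].
have [m pm nE] := pfactor_coprime p_pr n0; rewrite -ea in nE.
have pm' : ~~ (p%:Z %| m%:Z * y ^+ n.-1)%Z.
  rewrite dvdzE abszM /= Euclid_dvdM // negb_or -prime_coprime // pm /=.
  by rewrite abszX Euclid_dvdX // negb_and; move: py; rewrite dvdzE /= => ->.
have [z hz] := linear_congruence (- w) p_pr pm'.
exists (y + p%:Z ^+ r * z).
  apply: contra py; rewrite rpredDr // dvdz_mulr // -(prednK r0) exprS dvdz_mulr //.
have pn : (p ^ a %| n)%N by rewrite nE dvdn_mull.
have /eqP := power_step_expansion y z p_pr ap pn r0 n0.
rewrite eqz_mod_dvd => h; rewrite -(subrK (y ^+ n + (n * p ^ r)%:Z * y ^+ n.-1 * z) ((_ + _) ^+ n)).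
rewrite -addrA rpredD //.
have -> : y ^+ n + (n * p ^ r)%:Z * y ^+ n.-1 * z - u =
  (p ^ (a + r))%:Z * (m%:Z * y ^+ n.-1 * z - - w).
  have nz : (n * p ^ r = m * p ^ (a + r))%N by rewrite {1}nE -mulnA expnD.
  by rewrite addrAC hw nz PoszM; ring.
by rewrite expnSr PoszM dvdz_mul.
Qed.

Lemma hensel_power p n (u x : int) e : prime p -> odd n ->
  ~~ (p%:Z %| x)%Z -> ((p ^ (logn p n).+1)%:Z %| x ^+ n - u)%Z ->
  exists y, ((p ^ e)%:Z %| y ^+ n - u)%Z.
Proof.
move=> p_pr on px h; have n0 := odd_gt0 on.
(* The prime [2] does not divide the odd [n], so for [p = 2] the valuation is [0]. *)
have ap : (logn p n == 0)%N || odd p.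
  rewrite -leqn0 leqNgt logn_gt0 mem_primes p_pr n0 /=.
  by case: (boolP (p %| n)%N) => //= /dvdnP[q e']; move: on; rewrite e' oddM => /andP[].
suff [y _ hy] : exists2 y, ~~ (p%:Z %| y)%Z & ((p ^ (logn p n + e.+1))%:Z %| y ^+ n - u)%Z.
  exists y; apply: dvdz_trans hy; rewrite dvdzE /= dvdn_exp2l //; lia.
elim: e => [|e [y py hy]]; first by exists x; rewrite ?addn1.
have [y' py' hy'] := hensel_power_step p_pr ap n0 erefl (ltn0Sn e) py hy.
by exists y'; rewrite ?addnS // -addnS.
Qed.

End Hensel.

Section PowerSumCongruence.
Local Open Scope ring_scope.

Lemma sum_update_power (l n : nat) (x : 'I_l -> int) (i : 'I_l) (y : int) :
  \sum_j (if j == i then y else x j) ^+ n = \sum_j x j ^+ n + (y ^+ n - x i ^+ n).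
Proof.
rewrite (bigD1 i) //= eqxx [in RHS](bigD1 i) //=.
rewrite (eq_bigr (fun j => x j ^+ n)); last by move=> j /negPf ->.
ring.
Qed.

Lemma power_sum_prime_power (l n p e : nat) (k : int) (x : 'I_l -> int) :
  prime p -> odd n -> (1 < l)%N ->
  ((p ^ (logn p n).+1)%:Z %| \sum_i x i ^+ n - k)%Z ->
  exists x' : 'I_l -> int, ((p ^ e)%:Z %| \sum_i x' i ^+ n - k)%Z.
Proof.
move=> p_pr on l1 hx; have n0 := odd_gt0 on.
wlog [i px] : x hx / exists i, ~~ (p%:Z %| x i)%Z.
  (* If [p] divides every [x i], the power sum vanishes modulo [p ^ n], so [logn p n < n] makes [k]
     vanish to the given precision. Then [1, -1, 0, ...] is a solution with a unit coordinate, as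
     [n] is odd. *)
  move=> W; have [/existsP[i pi]|/existsPn allp] :=
    boolP [exists i, ~~ (p%:Z %| x i)%Z]; first by apply: (W x) => //; exists i.
  have hn : (logn p n < n)%N by rewrite ltn_logl.
  pose i0 : 'I_l := Ordinal (ltnW l1); pose i1 : 'I_l := Ordinal l1.
  apply: (W (fun i => if i == i0 then 1 else if i == i1 then -1 else 0)); last first.
    by exists i0; rewrite eqxx dvdzE /= dvdn1; case: (p) p_pr => [|[]].
  rewrite (bigD1 i0) //= (bigD1 i1) //= big1; last first.
    by move=> i /andP[/negPf -> /negPf ->]; rewrite expr0n; case: (n) n0.
  rewrite expr1n -signr_odd on addr0 expr1 subrr sub0r.
  rewrite rpredN -[k](subKr (\sum_i x i ^+ n)); apply: rpredB => //.
  apply: rpred_sum => i _; apply: dvdz_trans (_ : (p ^ n)%:Z %| _)%Z.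
    by rewrite dvdzE /= dvdn_exp2l.
  rewrite -[(p ^ n)%:Z]natz natrX natz; apply: dvdz_exp2r.
  by have := allp i; rewrite negbK.
set u := k - (\sum_j x j ^+ n - x i ^+ n).
have [|y hy] := @hensel_power p n u (x i) e p_pr on px.
  by rewrite /u (_ : _ - _ = \sum_j x j ^+ n - k) //; ring.
exists (fun j => if j == i then y else x j); rewrite sum_update_power.
by move: hy; congr (_ %| _)%Z; rewrite /u; ring.
Qed.

Definition solvable_modulus (l n : nat) (k : int) (m : nat) :=
  exists x : 'I_l -> int, (m%:Z %| \sum_i x i ^+ n - k)%Z.

Lemma power_sum_chinese l n k m1 m2 : coprime m1 m2 ->
  solvable_modulus l n k m1 -> solvable_modulus l n k m2 ->
  solvable_modulus l n k (m1 * m2).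
Proof.
move=> co [x hx] [y hy]; exists (fun i => zchinese m1 m2 (x i) (y i)).
have co' : coprimez m1 m2 by [].
have lift m (z w : 'I_l -> int) : (forall i, z i = w i %[mod m])%Z ->
    (m %| \sum_i w i ^+ n - k)%Z -> (m %| \sum_i z i ^+ n - k)%Z.
  move=> zw h; rewrite -[_ - k](subrKA (\sum_i w i ^+ n)).
  rewrite rpredD // -sumrB; apply: rpred_sum => i _.
  by rewrite subrXX dvdz_mulr // -eqz_mod_dvd zw.
rewrite PoszM Gauss_dvdz //; apply/andP; split; [apply: (lift _ _ x)|apply: (lift _ _ y)] => // i.
  exact: zchinese_modl.
exact: zchinese_modr.
Qed.

Lemma power_sum_local_global l n k :
  (forall p e, prime p -> solvable_modulus l n k (p ^ e)) ->
  forall m, (0 < m)%N -> solvable_modulus l n k m.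
Proof.
move=> loc m; have [b] := ubnP m; elim: b m => // b IH m /ltnSE mb m0.
have [m1|m1] := leqP m 1.
  by exists (fun _ => 0); rewrite (_ : m = 1%N) ?dvd1z //; lia.
have p_pr := pdiv_prime m1; have [c pc mE] := pfactor_coprime p_pr m0.
have c0 : (0 < c)%N by move: m0; rewrite mE muln_gt0 => /andP[].
rewrite mE; apply: power_sum_chinese; first by rewrite coprime_sym coprimeXl.
  apply: IH => //; apply: leq_trans mb; rewrite [X in (_ < X)%N]mE.
  rewrite ltn_Pmulr // -(exp1n (logn (pdiv m) m)) ltn_exp2r ?prime_gt1 //.
  by rewrite logn_gt0 pi_pdiv.
exact: loc.
Qed.

End PowerSumCongruence.

(* Imported only now: [classical_sets] shadows the lemma names of [finset]. *)
From mathcomp Require Import all_classical all_reals all_analysis.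

(** * Recurrence along polynomial sequences *)

Section ConvexPolynomials.
Local Open Scope ring_scope.
Variable R : realType.
Implicit Types (a b : {poly R}) (M q : nat).

(** An element of the convex hull of the ['X^j] with [M | j]: the value at [1] is the sum of the
    coefficients. *)
Definition convex_poly M a :=
  [/\ forall i, 0 <= a`_i, a.[1] = 1 & forall i, a`_i != 0 -> (M %| i)%N].

Lemma convex_polyW M q a : (M %| q)%N -> convex_poly q a -> convex_poly M a.
Proof. by move=> Mq [a0 a1 qa]; split=> // i /qa; apply: dvdn_trans. Qed.

Lemma convex_polyXn M j : (M %| j)%N -> convex_poly M 'X^j.
Proof.
move=> Mj; split=> [i||i]; rewrite ?coefXn ?ler0n //.
  by rewrite hornerXn expr1n.
by have [->|_] := eqVneq i j; rewrite // eqxx.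
Qed.

Lemma convex_polyM M a b : convex_poly M a -> convex_poly M b -> convex_poly M (a * b).
Proof.
move=> [a0 a1 Ma] [b0 b1 Mb]; split=> [i||i].
- by rewrite coefM sumr_ge0 // => j _; rewrite mulr_ge0.
- by rewrite hornerM a1 b1 mulr1.
rewrite coefM => h; have [j] : exists j : 'I_i.+1, a`_j * b`_(i - j) != 0.
  apply/existsP; apply: contraNT h => /existsPn h.
  by rewrite big1 // => j _; apply/eqP; have := h j; rewrite negbK.
rewrite mulf_eq0 negb_or => /andP[/Ma aj /Mb bj].
by rewrite -(subnKC (ltn_ord j : j <= i)%N) dvdn_add.
Qed.

Lemma convex_poly_mid M a b : convex_poly M a -> convex_poly M b ->
  convex_poly M (2^-1 *: (a + b)).
Proof.
move=> [a0 a1 Ma] [b0 b1 Mb]; split=> [i||i].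
- by rewrite coefZ coefD mulr_ge0 ?invr_ge0 ?addr_ge0.
- by rewrite hornerZ hornerD a1 b1; lra.
rewrite coefZ coefD; have [ai|/Ma //] := eqVneq a`_i 0.
have [bi|/Mb //] := eqVneq b`_i 0.
by rewrite ai bi addr0 mulr0 eqxx.
Qed.

Lemma convex_poly_weights M a : convex_poly M a -> \sum_(i < size a) a`_i = 1.
Proof.
move=> [_ <- _]; rewrite horner_coef; apply: eq_bigr => i _.
by rewrite expr1n mulr1.
Qed.

End ConvexPolynomials.

Section PolynomialSequences.
Variable M : nat.
Implicit Types (c : nat -> nat) (g : nat -> nat).

(** Natural coefficients let [g y] serve as an exponent of ['X], and survive both translation and
    differencing. *)
Definition poly_seq d g := exists c, [/\ 0 < c d, forall i, 0 < i -> M %| c i &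
  forall y, g y = \sum_(i < d.+1) c i * y ^ i].

Lemma poly_seq_translate c d h y :
  \sum_(i < d.+1) c i * (y + h) ^ i =
  \sum_(j < d.+1) (\sum_(i < d.+1) c i * ('C(i, j) * h ^ (i - j))) * y ^ j.
Proof.
under [RHS]eq_bigr => j _ do rewrite big_distrl /=.
rewrite [RHS]exchange_big /=; apply: eq_bigr => i _.
rewrite addnC expnDn big_distrr /=.
have le_id : i.+1 <= d.+1 by [].
rewrite (big_ord_widen d.+1 (fun j => c i * ('C(i, j) * (h ^ (i - j) * y ^ j)))) //.
rewrite big_mkcond; apply: eq_bigr => j _ /=.
by case: ltnP => [_|ij]; rewrite ?mulnA // bin_small ?mul0n ?muln0.
Qed.

Lemma poly_seq_shift d g h : poly_seq d g -> poly_seq d (fun y => g (y + h)).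
Proof.
move=> [c [cd Mc gE]].
exists (fun j => \sum_(i < d.+1) c i * ('C(i, j) * h ^ (i - j))); split=> [|j j0|y].
- rewrite (bigD1 ord_max) //= binn subnn mul1n muln1; lia.
- apply: dvdn_sum => i _; have [i0|i0] := posnP i.
    by rewrite i0 bin_small // muln0.
  by rewrite dvdn_mulr ?Mc.
by rewrite gE poly_seq_translate.
Qed.

Lemma poly_seq_difference d g h : 0 < h -> poly_seq d.+2 g ->
  exists2 g', poly_seq d.+1 g' & forall y, g (y + h) = g y + g' y.
Proof.
move=> h0 [c [cd Mc gE]].
(* The [j]-th coefficient of [g (y + h)] without its diagonal term [c j]: the difference is formed
   without subtracting. *)
pose e j := \sum_(i < d.+3 | i != j :> nat) c i * ('C(i, j) * h ^ (i - j)).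
have eE j : j < d.+3 -> \sum_(i < d.+3) c i * ('C(i, j) * h ^ (i - j)) = c j + e j.
  move=> jd; rewrite (bigD1 (Ordinal jd)) //= binn subnn mul1n muln1; congr (_ + _).
exists (fun y => \sum_(j < d.+2) e j * y ^ j).
  exists e; split=> // [|j j0].
    rewrite /e (bigD1 ord_max) /=; last by rewrite neq_ltn ltnSn orbT.
    rewrite binSn subSnn expn1; have : 0 < c d.+2 * (d.+2 * h) by rewrite !muln_gt0 cd h0.
    lia.
  apply: dvdn_sum => i _; have [i0|i0] := posnP i.
    by rewrite i0 bin_small // muln0.
  by rewrite dvdn_mulr ?Mc.
move=> y; rewrite !gE poly_seq_translate.
under eq_bigr => j _ do rewrite eE // mulnDl.
rewrite big_split /=; congr (_ + _); rewrite big_ord_recr /=.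
rewrite [e d.+2]big1 ?mul0n ?addn0 // => i id.
have i2 : i < d.+2 by have := ltn_ord i; lia.
by rewrite bin_small ?muln0.
Qed.

End PolynomialSequences.

Lemma eventually_all (P : nat -> nat -> Prop) L :
  (forall l, l < L -> exists Y0, forall Y, Y0 <= Y -> P l Y) ->
  exists Y0, forall Y, Y0 <= Y -> forall l, l < L -> P l Y.
Proof.
elim: L => [|L IH] h; first by exists 0.
have [|Y1 h1] := IH; first by move=> l lL; apply: h; apply: ltnW.
have [Y2 h2] := h L (ltnSn L).
exists (maxn Y1 Y2) => Y; rewrite geq_max => /andP[y1 y2] l.
by rewrite ltnS leq_eqVlt => /orP[/eqP ->|lL]; [apply: h2|apply: h1].
Qed.

(** * Ergodic averages in a stationary semi-inner-product space *)

Section Stationary.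
Local Open Scope ring_scope.
Variables (R : realType) (B : {poly R} -> {poly R} -> R).
Hypothesis BC : forall p q, B p q = B q p.
Hypothesis BD : forall p q r, B (p + q) r = B p r + B q r.
Hypothesis BZ : forall c p r, B (c *: p) r = c * B p r.
Hypothesis B_ge0 : forall p, 0 <= B p p.
Hypothesis BX : forall p q, B ('X * p) ('X * q) = B p q.
Local Notation N p := (B p p).
Implicit Types (p q r u w : {poly R}) (z : nat -> {poly R}).

Let BDr p q r : B p (q + r) = B p q + B p r.
Proof. by rewrite BC BD !(BC p). Qed.
Let BZr c p q : B p (c *: q) = c * B p q.
Proof. by rewrite BC BZ (BC p). Qed.
Let BN p q : B (- p) q = - B p q.
Proof. by rewrite -scaleN1r BZ mulN1r. Qed.
Let BNr p q : B p (- q) = - B p q.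
Proof. by rewrite BC BN (BC p). Qed.
Let B0 q : B 0 q = 0.
Proof. by rewrite -(scale0r 0) BZ mul0r. Qed.
Let BE := (BD, BDr, BZ, BZr, BN, BNr).

Let Bsum (I : finType) (P : pred I) (f : I -> {poly R}) q :
  B (\sum_(i | P i) f i) q = \sum_(i | P i) B (f i) q.
Proof. by apply: (big_morph (fun p => B p q)) => // x y; rewrite BD. Qed.

Lemma form_Xn n p q : B ('X^n * p) ('X^n * q) = B p q.
Proof. by elim: n => [|n IH]; rewrite ?mul1r // !exprS -!mulrA BX. Qed.

Lemma parallelogram p q : N (p + q) + N (p - q) = 2 * N p + 2 * N q.
Proof. by rewrite !BE (BC q p); ring. Qed.

Lemma form_add_le p q : N (p + q) <= 2 * N p + 2 * N q.
Proof. by rewrite -parallelogram lerDl. Qed.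

Lemma form_sub_le p q : N (p - q) <= 2 * N p + 2 * N q.
Proof. by rewrite -parallelogram lerDr. Qed.

(** Cauchy-Schwarz without square roots: [N] is a squared seminorm, and both bounds come from
    expanding it at [t p + s q] and [t p - s q]. *)
Lemma form_bound (s t : R) p q : 0 < s -> 0 < t -> N p <= s ^+ 2 -> N q <= t ^+ 2 ->
  - (s * t) <= B p q <= s * t.
Proof.
move=> s0 t0 ps qt; have h1 := B_ge0 (t *: p + s *: q).
have h2 := B_ge0 (t *: p - s *: q).
rewrite !BE (BC q p) in h1 h2.
have h3 : t * (t * N p) <= t * (t * s ^+ 2) by rewrite !ler_pM2l.
have h4 : s * (s * N q) <= s * (s * t ^+ 2) by rewrite !ler_pM2l.
have st : 0 < s * t by rewrite mulr_gt0.
apply/andP; split; rewrite -(ler_pM2l st); nra.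
Qed.

Lemma jensen (I : finType) (c : I -> R) (f : I -> {poly R}) :
  (forall i, 0 <= c i) -> \sum_i c i = 1 ->
  N (\sum_i c i *: f i) <= \sum_i c i * N (f i).
Proof.
move=> c0 c1; set m := \sum_i _.
have : 0 <= \sum_i c i * N (f i - m) by apply: sumr_ge0 => i _; rewrite mulr_ge0.
have -> : \sum_i c i * N (f i - m) =
  \sum_i c i * N (f i) - 2 * (\sum_i c i * B (f i) m) + (\sum_i c i) * N m.
  rewrite mulr_sumr mulr_suml -sumrB -big_split /=; apply: eq_bigr => i _.
  by rewrite !BE (BC m (f i)); ring.
have -> : \sum_i c i * B (f i) m = N m.
  by rewrite {2}/m Bsum; apply: eq_bigr => i _; rewrite BZ.
by rewrite c1; lra.
Qed.

Lemma jensen_le (I : finType) (c : I -> R) (f : I -> {poly R}) (C : R) :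
  (forall i, 0 <= c i) -> \sum_i c i = 1 ->
  (forall i, c i != 0 -> N (f i) <= C) -> N (\sum_i c i *: f i) <= C.
Proof.
move=> c0 c1 fC; apply: le_trans (jensen _ c0 c1) _.
rewrite -[C]mul1r -c1 mulr_suml; apply: ler_sum => i _.
have [->|ci] := eqVneq (c i) 0; first by rewrite !mul0r.
by rewrite ler_wpM2l // fC.
Qed.

Lemma convex_sum_le M a (f : nat -> {poly R}) (C : R) : convex_poly M a ->
  (forall i, (M %| i)%N -> (i < size a)%N -> N (f i) <= C) ->
  N (\sum_(i < size a) a`_i *: f i) <= C.
Proof.
move=> ca fC; have [a0 _ Ma] := ca; apply: jensen_le => [i||i ai] //.
  exact: convex_poly_weights ca.
by apply: fC; rewrite ?ltn_ord // Ma.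
Qed.

Lemma convex_mulE a w : a * w = \sum_(i < size a) a`_i *: ('X^i * w).
Proof.
rewrite -[a in LHS]coefK poly_def mulr_suml; apply: eq_bigr => i _.
by rewrite scalerAl.
Qed.

Lemma convex_mul_le M a w : convex_poly M a -> N (a * w) <= N w.
Proof.
move=> ca; rewrite convex_mulE.
by apply: (convex_sum_le (f := fun i => 'X^i * w) ca) => i _ _; rewrite form_Xn.
Qed.

Definition avg Y z := Y%:R^-1 *: \sum_(y < Y) z y.

Lemma avgE Y z : avg Y z = \sum_(y < Y) Y%:R^-1 *: z y.
Proof. by rewrite /avg scaler_sumr. Qed.

Lemma avg_weights Y : (0 < Y)%N -> \sum_(y < Y) Y%:R^-1 = 1 :> R.
Proof.
by move=> Y0; rewrite sumr_const card_ord -(mulr_natr Y%:R^-1) mulVf // pnatr_eq0 -lt0n.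
Qed.

Lemma avg_le Y z (C : R) : (0 < Y)%N -> (forall y, (y < Y)%N -> N (z y) <= C) ->
  N (avg Y z) <= C.
Proof.
move=> Y0 zC; rewrite avgE; apply: jensen_le => [i||i _]; rewrite ?invr_ge0 ?ler0n //.
  exact: avg_weights.
exact: zC.
Qed.

Lemma avgD Y z1 z2 : avg Y (fun y => z1 y + z2 y) = avg Y z1 + avg Y z2.
Proof. by rewrite /avg big_split scalerDr. Qed.

Lemma form_avg Y z q : B (avg Y z) q = Y%:R^-1 * \sum_(y < Y) B (z y) q.
Proof. by rewrite /avg BZ Bsum. Qed.

Lemma avg_shift_le Y z (W : R) i : (0 < Y)%N -> (forall y, N (z y) <= W) ->
  N (avg Y z - avg Y (fun y => z (y + i)%N)) <= 4 * W * (i%:R / Y%:R) ^+ 2.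
Proof.
move=> Y0 zW; case: (posnP i) => [->|i0].
  have -> : avg Y (fun y => z (y + 0)%N) = avg Y z.
    by congr (_ *: _); apply: eq_bigr => y _; rewrite addn0.
  by rewrite subrr B0 mul0r expr0n mulr0.
have -> : avg Y z - avg Y (fun y => z (y + i)%N) =
    (i%:R / Y%:R) *: avg i (fun j => z j - z (Y + j)%N).
  rewrite /avg -scalerBr scalerA mulrAC divff ?pnatr_eq0 -?lt0n // mul1r.
  congr (_ *: _).
  have e1 : \sum_(y < Y + i) z y = \sum_(y < Y) z y + \sum_(j < i) z (Y + j)%N.
    by rewrite big_split_ord.
  have e2 : \sum_(y < Y + i) z y = \sum_(j < i) z j + \sum_(y < Y) z (y + i)%N.
    rewrite addnC big_split_ord /=; congr (_ + _); apply: eq_bigr => y _.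
    by rewrite addnC.
  by rewrite sumrB; apply/eqP; rewrite subr_eq addrAC eq_sym subr_eq -e2 e1.
rewrite BZ BZr mulrA -expr2 mulrC ler_wpM2r ?sqr_ge0 //.
apply: avg_le => // j _; apply: le_trans (form_sub_le _ _) _.
by have := zW j; have := zW (Y + j)%N; lra.
Qed.

(* The van der Corput inequality: averaging over the shifts [l < L] turns the norm
   of the mean of [z] into correlations of [z] with its own shifts. *)
Lemma van_der_corput Y L z (W k : R) : (0 < Y)%N -> (0 < L)%N ->
  (forall y, N (z y) <= W) -> 0 <= k ->
  (forall l l', (l' < l < L)%N ->
     Y%:R^-1 * \sum_(y < Y) B (z (y + l)%N) (z (y + l')%N) <= k) ->
  N (avg Y z) <= 8 * W * (L%:R / Y%:R) ^+ 2 + 2 * (W / L%:R + k).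
Proof.
move=> Y0 L0 zW k0 corr.
have Lp : 0 < L%:R :> R by rewrite ltr0n.
have Yp : 0 < Y%:R :> R by rewrite ltr0n.
pose beta := avg Y (fun y => avg L (fun l => z (y + l)%N)).
have W0 : 0 <= W by apply: le_trans (zW 0%N).
have d1 : N (avg Y z - beta) <= 4 * W * (L%:R / Y%:R) ^+ 2.
  have -> : avg Y z - beta =
      \sum_(l < L) L%:R^-1 *: (avg Y z - avg Y (fun y => z (y + l)%N)).
    transitivity (avg Y z - avg L (fun l => avg Y (fun y => z (y + l)%N))).
      congr (_ - _); rewrite /beta /avg.
      rewrite -!scaler_sumr exchange_big /= !scalerA mulrC.
      by [].
    rewrite (avgE L) -[avg Y z in LHS]scale1r -[X in X *: avg Y z](avg_weights L0).
    rewrite scaler_suml -sumrB.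
    by apply: eq_bigr => l _; rewrite scalerBr.
  apply: jensen_le => [l||l _]; rewrite ?invr_ge0 ?ler0n ?avg_weights //.
  apply: le_trans (avg_shift_le _ Y0 zW) _.
  rewrite ler_wpM2l ?mulr_ge0 // lerXn2r ?nnegrE ?divr_ge0 // ler_pM2r ?invr_gt0 //.
  by rewrite ler_nat ltnW.
have corr' (l l' : 'I_L) : Y%:R^-1 * (\sum_(y < Y) B (z (y + l)%N) (z (y + l')%N))
    <= k + (if l == l' then W else 0).
  have [->|nll] := eqVneq l l'.
    apply: le_trans (_ : W <= _); last by rewrite lerDr.
    rewrite -[leRHS]mul1r -[X in _ <= X * _](avg_weights Y0) mulr_suml mulr_sumr.
    by apply: ler_sum => y _; rewrite ler_wpM2l ?invr_ge0.
  rewrite addr0; have : (l < l')%N || (l' < l)%N by rewrite -neq_ltn.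
  case/orP => ll; last by apply: corr; rewrite ll ltn_ord.
  rewrite (eq_bigr (fun y : 'I_Y => B (z (y + l')%N) (z (y + l)%N))) => [|y _]; last exact: BC.
  by apply: corr; rewrite ll ltn_ord.
have d2 : N beta <= W / L%:R + k.
  rewrite /beta avgE.
  apply: le_trans (@jensen 'I_Y (fun _ => Y%:R^-1)
    (fun y => avg L (fun l => z (y + l)%N)) _ (avg_weights Y0)) _.
    by move=> y; rewrite invr_ge0.
  have -> : \sum_(y < Y) Y%:R^-1 * N (avg L (fun l => z (y + l)%N)) =
     \sum_(l < L) L%:R^-1 * \sum_(l' < L) L%:R^-1 *
       (Y%:R^-1 * \sum_(y < Y) B (z (y + l)%N) (z (y + l')%N)).
    under eq_bigr => y _.
      rewrite form_avg mulr_sumr mulr_sumr.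
      under eq_bigr => l _ do rewrite BC form_avg !mulr_sumr.
      over.
    rewrite exchange_big /=; apply: eq_bigr => l _.
    rewrite exchange_big mulr_sumr /=; apply: eq_bigr => l' _.
    rewrite !mulr_sumr; apply: eq_bigr => y _; rewrite BC; ring.
  apply: le_trans (_ : \sum_(l < L) L%:R^-1 * (\sum_(l' < L) L%:R^-1 *
      (k + if l == l' then W else 0)) <= _).
    apply: ler_sum => l _; rewrite ler_wpM2l ?invr_ge0 //.
    by apply: ler_sum => l' _; rewrite ler_wpM2l ?invr_ge0.
  under eq_bigr => l _.
    under eq_bigr => l' _ do rewrite mulrDr.
    rewrite big_split /= -mulr_suml avg_weights // mul1r.
    rewrite (bigD1 l) //= eqxx big1 ?addr0; last first.
      by move=> i; rewrite eq_sym => /negPf ->; rewrite mulr0.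
    over.
  rewrite -mulr_suml avg_weights // mul1r addrC mulrC //.
have := form_add_le (avg Y z - beta) beta; rewrite subrK.
move: d1 d2; set x := _ ^+ 2; set y := _ / _; lra.
Qed.


Lemma eventually_small (C eta : R) : 0 < eta ->
  exists Y0, (0 < Y0)%N /\ forall Y, (Y0 <= Y)%N -> C * (1 / Y%:R) ^+ 2 <= eta.
Proof.
move=> eta0; pose Y1 := Num.bound (`|C| / eta).
exists Y1.+1; split=> // Y hY.
have Y0 : 0 < Y%:R :> R by rewrite ltr0n (leq_trans _ hY).
have h1 : `|C| / eta < Y%:R.
  apply: lt_le_trans (archi_boundP _) _; first by rewrite divr_ge0 // ltW.
  by rewrite ler_nat ltnW.
have h2 : `|C| <= eta * Y%:R.
  by apply: ltW; rewrite mulrC -ltr_pdivrMr.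
rewrite expr_div_n expr1n mulrA mulr1 ler_pdivrMr ?exprn_gt0 //.
apply: le_trans (ler_norm C) (le_trans h2 _).
rewrite ler_pM2l // expr2 ler_peMl ?(ltW Y0) //.
by rewrite ler1n (leq_trans _ hY).
Qed.

(** Expresses without limits that, for every positive multiple [q] of [M], the component of [w]
    fixed by ['X^q] has squared norm at most [eps]. *)
Definition averaged_small (M : nat) w (eps : R) := forall q : nat, (0 < q)%N -> (M %| q)%N ->
  exists2 a, convex_poly q a & N (a * w) <= eps.

(** Here [g (y + i) = g y + q i], so a convex combination of the ['X^(q j)] only shifts the
    averaging window and hardly changes the mean, while it makes each term small. *)
Lemma linear_averages M w (eta : R) g : 0 < eta -> N w <= 4 ->
  averaged_small M w (eta / 4) -> poly_seq M 1 g ->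
  exists Y0, forall Y, (Y0 <= Y)%N -> N (avg Y (fun y => 'X^(g y) * w)) <= eta.
Proof.
move=> eta0 w4 sm [c [c1 Mc gE]]; set q := c 1%N.
have [a ca aw] := sm q c1 (Mc 1%N isT).
have [a0 a1 qa] := ca.
set s := size a.
have [Y0 [Y00 hY]] := eventually_small (4 * 4 * s%:R ^+ 2) (divr_gt0 eta0 (ltr0n R 4)).
exists Y0 => Y YY0; have Yp : (0 < Y)%N by apply: leq_trans YY0.
pose z y := 'X^(g y) * w.
have z4 y : N (z y) <= 4 by rewrite /z form_Xn.
have gq y i : z (y + i)%N = 'X^(q * i) * z y.
  rewrite /z mulrA -exprD; congr ('X^_ * _); rewrite !gE !big_ord_recl !big_ord0 /=.
  by rewrite /q /bump /=; ring.
have dz : N (avg Y z - avg Y (fun y => a * z y)) <= eta / 4.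
  have -> : avg Y z - avg Y (fun y => a * z y) =
      \sum_(i < s) a`_i *: (avg Y z - avg Y (fun y => 'X^i * z y)).
    under eq_bigr => i _ do rewrite scalerBr.
    rewrite sumrB -scaler_suml (convex_poly_weights ca) scale1r; congr (_ - _).
    rewrite /avg; under eq_bigr => y _ do rewrite convex_mulE.
    rewrite exchange_big scaler_sumr /=; apply: eq_bigr => i _.
    by rewrite -scaler_sumr !scalerA mulrC.
  apply: (convex_sum_le (f := fun i => avg Y z - avg Y (fun y => 'X^i * z y)) ca).
  move=> i /dvdnP[j ->] js; apply: le_trans (hY Y YY0).
  have -> : avg Y (fun y => 'X^(j * q) * z y) = avg Y (fun y => z (y + j)%N).
    by congr (_ *: _); apply: eq_bigr => y _; rewrite gq mulnC.
  apply: le_trans (avg_shift_le _ Yp z4) _.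
  have -> : 4 * 4 * s%:R ^+ 2 * (1 / Y%:R) ^+ 2 = 4 * 4 * (s%:R / Y%:R) ^+ 2 :> R.
    by rewrite !expr_div_n expr1n !mulrA mulr1.
  rewrite ler_wpM2l ?mulr_ge0 // lerXn2r ?nnegrE ?divr_ge0 //.
  rewrite ler_pM2r ?invr_gt0 ?ltr0n // ler_nat; apply: leq_trans (ltnW js).
  by rewrite leq_pmulr.
have az : N (avg Y (fun y => a * z y)) <= eta / 4.
  apply: avg_le => // y _; apply: le_trans aw.
  by rewrite /z mulrCA form_Xn.
have := form_add_le (avg Y z - avg Y (fun y => a * z y)) (avg Y (fun y => a * z y)).
by rewrite subrK; lra.
Qed.

(** Two shifts of [z] correlate, after cancelling a common power of ['X], like an average along a
    sequence of degree one less. [eps] depends on [d] and [eta] alone because [M] and [w] are chosen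
    after it. *)
Lemma polynomial_averages d (eta : R) : 0 < eta -> exists2 eps : R, 0 < eps &
  forall M w g, N w <= 4 -> averaged_small M w eps -> poly_seq M d.+1 g ->
  exists Y0, forall Y, (Y0 <= Y)%N -> N (avg Y (fun y => 'X^(g y) * w)) <= eta.
Proof.
elim: d eta => [|d IH] eta eta0.
  by exists (eta / 4); [lra | move=> M w g; apply: linear_averages].
(* With [4 / L <= k] the van der Corput bound will be at most [eta / 2 + 2 (k + k) = eta]. *)
pose k := eta / 8; have k0 : 0 < k by rewrite /k; lra.
have k20 : 0 < k / 2 by lra.
have [eps eps0 small] := IH ((k / 2) ^+ 2) (exprn_gt0 2 k20).
exists eps => // M w g w4 sm pg.
pose L := (Num.bound (32 / eta)).+1.
have Lp : 0 < L%:R :> R by rewrite ltr0n.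
have hL : 4 / L%:R <= k.
  rewrite ler_pdivrMr // /k; have : 32 / eta < L%:R.
    apply: lt_le_trans (archi_boundP _) _; first by rewrite divr_ge0 // ltW.
    by rewrite ler_nat.
  rewrite ltr_pdivrMr //; lra.
pose z y := 'X^(g y) * w.
have z4 y : N (z y) <= 4 by rewrite /z form_Xn.
have [Y1 [Y10 h1]] := eventually_small (8 * 4 * L%:R ^+ 2) (divr_gt0 eta0 (ltr0n R 2)).
have corr l l' : (l' < l)%N -> exists Y0, forall Y, (Y0 <= Y)%N ->
    Y%:R^-1 * \sum_(y < Y) B (z (y + l)%N) (z (y + l')%N) <= k.
  move=> ll; have l0 : (0 < l - l')%N by rewrite subn_gt0.
  have [g' pg' g'E] := poly_seq_difference l0 (poly_seq_shift l' pg).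
  have [Y0 hY0] := small M w g' w4 sm pg'.
  exists Y0 => Y /hY0 hN.
  have -> : Y%:R^-1 * \sum_(y < Y) B (z (y + l)%N) (z (y + l')%N) =
            B (avg Y (fun y => 'X^(g' y) * w)) w.
    rewrite form_avg; congr (_ * _); apply: eq_bigr => y _.
    rewrite /z (_ : y + l = y + (l - l') + l')%N; last by lia.
    by rewrite g'E exprD -mulrA form_Xn.
  have w22 : N w <= 2 ^+ 2 by rewrite expr2; lra.
  have := form_bound k20 (ltr0n R 2) hN w22.
  by case/andP => _; rewrite divfK // pnatr_eq0.
have [Y2 h2] : exists Y0, forall Y, (Y0 <= Y)%N -> forall l, (l < L)%N ->
    forall l', (l' < l)%N -> Y%:R^-1 * \sum_(y < Y) B (z (y + l)%N) (z (y + l')%N) <= k.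
  apply: (@eventually_all (fun l Y => forall l', (l' < l)%N ->
    Y%:R^-1 * \sum_(y < Y) B (z (y + l)%N) (z (y + l')%N) <= k)) => l _.
  by apply: (@eventually_all (fun l' Y =>
    Y%:R^-1 * \sum_(y < Y) B (z (y + l)%N) (z (y + l')%N) <= k)) => l'; apply: corr.
exists (maxn Y1 Y2) => Y; rewrite geq_max => /andP[y1 y2].
have Yp : (0 < Y)%N by apply: leq_trans y1.
have := @van_der_corput Y L z 4 k Yp (ltn0Sn _) z4 (ltW k0).
have hc l l' : (l' < l < L)%N -> Y%:R^-1 * \sum_(y < Y) B (z (y + l)%N) (z (y + l')%N) <= k.
  by case/andP => ll lL; apply: h2.
move=> /(_ hc) hv; apply: le_trans hv _.
have -> : 8 * 4 * (L%:R / Y%:R) ^+ 2 = 8 * 4 * L%:R ^+ 2 * (1 / Y%:R) ^+ 2 :> R.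
  by rewrite !expr_div_n expr1n !mulrA mulr1.
have := h1 Y y1; move: hL; rewrite /k; lra.
Qed.


Definition least_norm M := inf [set N a | a in convex_poly M]%classic.

Lemma least_norm_has_inf M : has_inf [set N a | a in convex_poly M]%classic.
Proof.
split; last by exists 0 => _ [a _ <-].
by exists (N 'X^0), 'X^0 => //; apply: convex_polyXn.
Qed.

Lemma least_norm_le M a : convex_poly M a -> least_norm M <= N a.
Proof.
by move=> ca; apply: ge_inf; [exact: (least_norm_has_inf M).2 | exists a].
Qed.

Lemma least_norm_near M (eps : R) : 0 < eps ->
  exists2 a, convex_poly M a & N a <= least_norm M + eps.
Proof.
move=> eps0; have [_ [a ca <-] /ltW] := inf_adherent eps0 (least_norm_has_inf M).
by exists a.
Qed.

(** Least norms are bounded by [N 1], so some [M] comes within [eps] of their supremum; passing to a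
    multiple of [M] then gains almost nothing. *)
Lemma least_norm_maximal (eps : R) : 0 < eps -> exists2 M, (0 < M)%N &
  forall q : nat, (0 < q)%N -> least_norm q <= least_norm M + eps.
Proof.
move=> eps0; pose S := [set least_norm M | M in [set M | (0 < M)%N]]%classic.
have S_ub : has_ubound S.
  exists (N 1) => _ [M _ <-]; apply: least_norm_le.
  by rewrite -(expr0 'X); apply: convex_polyXn.
have hS : has_sup S by split=> //; exists (least_norm 1), 1%N.
have [_ [M M0 <-] /ltW h] := sup_adherent eps0 hS; exists M => // q q0.
by rewrite -lerBlDr; apply: le_trans h; rewrite lerD2r; apply: ub_le_sup => //; exists q.
Qed.

(** The midpoint lies in the same hull, so its norm is at least the infimum, and the parallelogram
    law bounds the difference. *)
Lemma convex_near_le M a b (eps : R) : convex_poly M a -> convex_poly M b ->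
  N a <= least_norm M + eps -> N b <= least_norm M + eps -> N (a - b) <= 4 * eps.
Proof.
move=> ca cb na nb; have := parallelogram a b.
have := least_norm_le (convex_poly_mid ca cb); rewrite BZ BZr; lra.
Qed.

Theorem positive_correlation d (delta : R) : 0 < delta -> N 1 <= 1 ->
  (forall p, (delta * p.[1]) ^+ 2 <= N p) ->
  exists2 M, (0 < M)%N & forall g, poly_seq M d.+1 g -> (forall y, (M %| g y)%N) ->
    exists y, 0 < B 'X^(g y) 1.
Proof.
(* Three errors of size [t] will be set against [delta ^ 2]. *)
move=> delta0 N1 Ndelta; pose t := delta ^+ 2 / 8.
have t0 : 0 < t by rewrite divr_gt0 ?exprn_gt0.
have t20 : 0 < t ^+ 2 by rewrite exprn_gt0.
have [eps eps0 small] := polynomial_averages d t20.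
pose e := Num.min (eps / 8) (t ^+ 2 / 4).
have e0 : 0 < e by rewrite lt_min !divr_gt0.
have e_eps : 8 * e <= eps.
  have : e <= eps / 8 by rewrite ge_min lexx.
  lra.
have e_t : 4 * e <= t ^+ 2.
  have : e <= t ^+ 2 / 4 by rewrite ge_min lexx orbT.
  lra.
have [M M0 maxM] := least_norm_maximal e0; exists M => // g pg Mg.
have [u cu nu] := least_norm_near M e0.
have N11 : N 1 <= 1 ^+ 2 by rewrite expr1n.
have uE : u = u * 1 by rewrite mulr1.
have Nu1 : N u <= 1 by rewrite uE; apply: le_trans (convex_mul_le 1 cu) N1.
have Xu j : (M %| j)%N -> N ('X^j * u - u) <= t ^+ 2.
  move=> Mj; apply: le_trans e_t; apply: (@convex_near_le M) => //.
    by apply: convex_polyM => //; apply: convex_polyXn.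
  by rewrite form_Xn.
have w4 : N (1 - u) <= 4 by apply: le_trans (form_sub_le _ _) _; lra.
(* Take [a] nearly minimal in the hull for [q]. By the choice of [M], both [a] and [a u] are within
   [2 e] of the least norm for [M], hence close together. *)
have sm : averaged_small M (1 - u) eps.
  move=> q q0 Mq; have [a ca na] := least_norm_near q e0.
  exists a => //; rewrite mulrBr mulr1; apply: le_trans e_eps.
  rewrite (_ : 8 * e = 4 * (2 * e)); last by ring.
  have caM := convex_polyW Mq ca.
  apply: (@convex_near_le M) => //; first exact: convex_polyM.
    by have := maxM q q0; lra.
  by apply: le_trans (convex_mul_le u caM) _; lra.
have [Y0 hY] := small M (1 - u) g w4 sm pg.
set Y := Y0.+1; have {}hY := hY Y (leqnSn _).
(* Expand the second factor of [N u = B u u]: as ['X^i * u] is near [u], each [B u 'X^i] is within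
   [t] of [B ('X^i * u) 'X^i = B u 1]. *)
have u1_ge : delta ^+ 2 - t <= B u 1.
  rewrite lerBlDr; apply: le_trans (_ : N u <= _).
    by have := Ndelta u; have [_ -> _] := cu; rewrite mulr1.
  rewrite {2}uE convex_mulE BC Bsum.
  apply: le_trans (_ : \sum_(i < size u) u`_i * (B u 1 + t) <= _); last first.
    by rewrite -mulr_suml (convex_poly_weights cu) mul1r.
  apply: ler_sum => i _; have [u0 _ Mu] := cu.
  have [->|ui] := eqVneq u`_i 0; first by rewrite scale0r B0 mul0r.
  rewrite BZ ler_wpM2l // BC.
  have := form_bound t0 ltr01 (Xu i (Mu _ ui)) _.
  move=> /(_ ('X^i * 1)); rewrite form_Xn => /(_ N11) /andP[h _].
  by move: h; rewrite BD BN form_Xn mulr1; lra.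
apply: contrapT => noy.
have neg y : B 'X^(g y) 1 <= 0.
  by rewrite leNgt; apply/negP => h; apply: noy; exists y.
have : B (avg Y (fun y => 'X^(g y))) 1 <= 0.
  by rewrite form_avg mulr_ge0_le0 ?invr_ge0 // sumr_le0.
have -> : avg Y (fun y => 'X^(g y)) =
    avg Y (fun y => 'X^(g y) * u) + avg Y (fun y => 'X^(g y) * (1 - u)).
  rewrite -avgD; congr (_ *: _); apply: eq_bigr => y _.
  by rewrite -mulrDr addrC subrK mulr1.
rewrite BD.
have /andP[h1 _] := form_bound t0 ltr01 hY N11.
have h2 : B u 1 - t <= B (avg Y (fun y => 'X^(g y) * u)) 1.
  rewrite form_avg mulrC ler_pdivlMr ?ltr0n // mulr_natr -[Y in leLHS]card_ord -sumr_const.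
  apply: ler_sum => y _.
  have /andP[h _] := form_bound t0 ltr01 (Xu _ (Mg y)) N11.
  by move: h; rewrite BD BN; lra.
by move: h1 h2 u1_ge; rewrite /t; have := exprn_gt0 2 delta0; lra.
Qed.

End Stationary.

(** * Invariant means *)

Section InvariantMean.
Local Open Scope classical_set_scope.
Local Open Scope ring_scope.
Import numFieldNormedType.Exports.
Variable R : realType.
Implicit Types (f g : int -> R) (m : nat).

Lemma ultrafilter_bounded_cvg (G : set_system nat) (a : nat -> R) (C : R) :
  UltraFilter G -> (forall m, `|a m| <= C) -> cvg (a @ G).
Proof.
move=> GU aC; have GP : ProperFilter G := ultra_proper.
have [l [_ cl]] : [set` `[- C, C]] `&` cluster (a @ G) !=set0.
  apply: (@segment_compact R (- C) C) => //.
  by apply: (@filterS _ G _ setT) filterT => m _; rewrite /= in_itv /= -ler_norml.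
apply/cvg_ex; exists l => V lV.
have [//|nV] := in_ultra_setVsetC (a @^-1` V) GU.
by have [y [/= nVy Vy]] := cl (~` V) V nV lV.
Qed.

Definition window_mean f m : R := (2 * m + 1)%:R^-1 * \sum_(j < 2 * m + 1) f (j%:Z - m%:Z).

Definition bounded_fun f := exists C, forall x, `|f x| <= C.

Lemma window_mean_bounded f : bounded_fun f ->
  exists C, forall m, `|window_mean f m| <= C.
Proof.
move=> [C fC]; exists C => m; have mp : 0 < (2 * m + 1)%:R :> R by rewrite ltr0n addn1.
rewrite /window_mean normrM normfV (gtr0_norm mp) mulrC ler_pdivrMr //.
apply: le_trans (ler_norm_sum _ _ _) _.
apply: le_trans (ler_sum _ (fun j _ => fC _)) _.
by rewrite sumr_const card_ord mulr_natr.
Qed.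

Lemma window_mean_shift f (C : R) m : (forall x, `|f x| <= C) ->
  `|window_mean (fun x => f (x + 1)) m - window_mean f m| <= 2 * C * m.+1%:R^-1.
Proof.
move=> fC; rewrite /window_mean -mulrBr -sumrB.
have -> : \sum_(j < 2 * m + 1) (f (j%:Z - m%:Z + 1) - f (j%:Z - m%:Z)) =
    f ((2 * m + 1)%:Z - m%:Z) - f (0%:Z - m%:Z).
  rewrite -(big_mkord xpredT (fun j => f (j%:Z - m%:Z + 1) - f (j%:Z - m%:Z))).
  rewrite -(telescope_sumr (fun j => f (j%:Z - m%:Z))) //.
  apply: eq_bigr => j _; congr (f _ - _); lia.
have mp : 0 < (2 * m + 1)%:R :> R by rewrite ltr0n addn1.
have C0 : 0 <= C by apply: le_trans (fC 0).
rewrite normrM normfV (gtr0_norm mp) mulrC ler_pM ?invr_ge0 ?ler0n //.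
  by apply: le_trans (ler_normB _ _) _; rewrite mulr_natl mulr2n lerD.
have le_m : m.+1%:R <= (2 * m + 1)%:R :> R by rewrite ler_nat; lia.
by rewrite lef_pV2 ?posrE.
Qed.

Record invariant_mean (L : (int -> R) -> R) : Prop := {
  meanD : forall f g, bounded_fun f -> bounded_fun g -> L (f \+ g) = L f + L g;
  meanZ : forall c f, bounded_fun f -> L (fun x => c * f x) = c * L f;
  mean_ge0 : forall f, bounded_fun f -> (forall x, 0 <= f x) -> 0 <= L f;
  mean_shift : forall f, bounded_fun f -> L (fun x => f (x + 1)) = L f;
  mean1 : L (fun=> 1) = 1 }.

(** [L] is the limit of window means along an ultrafilter containing the tails of [D], so lower
    bounds on [D] pass to [L]. Shifting changes a window mean only by its two end terms, which
    vanish in the limit. *)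
Lemma invariant_mean_exists (D : set nat) : (forall n, exists2 m, (n <= m)%N & D m) ->
  exists2 L, invariant_mean L & forall f (d : R), bounded_fun f ->
    (forall m, D m -> d <= window_mean f m) -> d <= L f.
Proof.
move=> Dinf.
pose F : set_system nat := [set A | exists n, forall m, (n <= m)%N -> D m -> A m].
have FP : ProperFilter F.
  apply: Build_ProperFilter_ex.
    by move=> A [n An]; have [m nm Dm] := Dinf n; exists m; apply: An nm Dm.
  split; first by exists 0%N.
    move=> A B [n An] [k Bk]; exists (maxn n k) => m; rewrite geq_max => /andP[nm km] Dm.
    by split; [apply: An|apply: Bk].
  by move=> A B AB [n An]; exists n => m nm Dm; apply/AB/An.
have [G [GU FG]] := ultraFilterLemma FP.
have GP : ProperFilter G := ultra_proper.
pose L f := lim (window_mean f @ G).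
have cvL f : bounded_fun f -> window_mean f @ G --> L f.
  by move=> /window_mean_bounded[C hC]; apply: ultrafilter_bounded_cvg hC.
have limL f l : window_mean f @ G --> l -> L f = l.
  by move=> h; apply: cvg_lim => //; exact: norm_hausdorff.
exists L; last first.
  move=> f d bf hd; apply: (limr_ge (F := G)); first exact: cvL.
  by apply: FG; exists 0%N => m _ Dm; apply: hd.
split.
- move=> f g bf bg; apply: limL.
  have -> : window_mean (f \+ g) = window_mean f \+ window_mean g.
    by apply/funext => m; rewrite /window_mean /= big_split mulrDr.
  by apply: cvgD; apply: cvL.
- move=> c f bf; apply: limL.
  have -> : window_mean (fun x => c * f x) = (fun m => c * window_mean f m).
    by apply/funext => m; rewrite /window_mean -mulr_sumr mulrCA.
  by apply: cvgM; [exact: cvg_cst | exact: cvL].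
- move=> f bf f0; apply: (limr_ge (F := G)); first exact: cvL.
  by apply: nearW => m; rewrite mulr_ge0 ?invr_ge0 ?ler0n // sumr_ge0.
- move=> f bf; apply: limL; have [C fC] := bf.
  have -> : window_mean (fun x => f (x + 1)) =
      (fun m => window_mean (fun x => f (x + 1)) m - window_mean f m) \+ window_mean f.
    by apply/funext => m /=; rewrite subrK.
  rewrite -[X in _ --> X]add0r; apply: cvgD; last exact: cvL.
  apply: norm_cvg0.
  have h0 : \forall m \near G, (fun=> 0) m <=
      `|window_mean (fun x => f (x + 1)) m - window_mean f m| <= 2 * C * m.+1%:R^-1.
    by apply: nearW => m; rewrite normr_ge0 window_mean_shift.
  apply: (squeeze_cvgr h0).
    exact: cvg_cst.
  rewrite -[X in _ --> X](mulr0 (2 * C)); apply: cvgM; first exact: cvg_cst.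
  apply: cvg_trans (@cvg_harmonic R) => A [n _ hA].
  by apply: FG; exists n => m nm _; apply: hA.
- apply: limL; rewrite (_ : window_mean _ = fun=> 1); first exact: cvg_cst.
  apply/funext => m; rewrite /window_mean sumr_const card_ord mulVf //.
Qed.

Section CorrelationForm.
Variables (L : (int -> R) -> R) (Lm : invariant_mean L) (v : int -> R).
Hypothesis v01 : forall x, 0 <= v x <= 1.
Implicit Types p q : {poly R}.

(* The indeterminate acts as the shift by [1] on the orbit of [v]. *)
Definition eval_shift p (x : int) := \sum_(i < size p) p`_i * v (x + i%:Z).

Lemma eval_shiftE n p x : (size p <= n)%N ->
  eval_shift p x = \sum_(i < n) p`_i * v (x + i%:Z).
Proof.
move=> pn; rewrite /eval_shift (big_ord_widen n (fun i => p`_i * v (x + i%:Z))) //.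
rewrite [LHS]big_mkcond; apply: eq_bigr => i _ /=.
by case: ltnP => // pi; rewrite nth_default // mul0r.
Qed.

Lemma eval_shiftD p q x : eval_shift (p + q) x = eval_shift p x + eval_shift q x.
Proof.
set n := maxn (size p) (size q).
rewrite !(@eval_shiftE n) ?leq_maxl ?leq_maxr // ?size_polyD //.
by rewrite -big_split; apply: eq_bigr => i _; rewrite coefD mulrDl.
Qed.

Lemma eval_shiftZ c p x : eval_shift (c *: p) x = c * eval_shift p x.
Proof.
rewrite (@eval_shiftE (size p)) ?size_scale_leq // /eval_shift mulr_sumr.
by apply: eq_bigr => i _; rewrite coefZ mulrA.
Qed.

Lemma eval_shiftX p x : eval_shift ('X * p) x = eval_shift p (x + 1).
Proof.
rewrite (@eval_shiftE (size p).+1); last first.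
  by rewrite -commr_polyX; case: (eqVneq p 0) => [->|p0]; rewrite ?mul0r ?size_poly0 // size_mulX.
rewrite big_ord_recl coefXM /= mul0r add0r; apply: eq_bigr => i _.
by rewrite coefXM /=; congr (_ * v _); rewrite /bump /=; lia.
Qed.

Lemma eval_shiftXn n x : eval_shift 'X^n x = v (x + n%:Z).
Proof.
rewrite /eval_shift size_polyXn big_ord_recr /= coefXn eqxx mul1r big1 ?add0r // => i _.
by rewrite coefXn (ltn_eqF (ltn_ord i)) mul0r.
Qed.

Lemma bounded_eval_shift p : bounded_fun (eval_shift p).
Proof.
exists (\sum_(i < size p) `|p`_i|) => x; apply: le_trans (ler_norm_sum _ _ _) _.
apply: ler_sum => i _; rewrite normrM ler_piMr //.
by have /andP[v0 v1] := v01 (x + i%:Z); rewrite ger0_norm.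
Qed.

Lemma bounded_funM f g : bounded_fun f -> bounded_fun g -> bounded_fun (f \* g).
Proof.
move=> [C fC] [E gE]; exists (C * E) => x; rewrite /= normrM.
by rewrite ler_pM.
Qed.

Lemma bounded_funD f g : bounded_fun f -> bounded_fun g -> bounded_fun (f \+ g).
Proof.
move=> [C fC] [E gE]; exists (C + E) => x; apply: le_trans (ler_normD _ _) _.
by rewrite lerD.
Qed.

Lemma bounded_cst (c : R) : bounded_fun (fun=> c).
Proof. by exists `|c|. Qed.

Definition corr_form p q := L (eval_shift p \* eval_shift q).

Let bM p q : bounded_fun (eval_shift p \* eval_shift q).
Proof. by apply: bounded_funM; apply: bounded_eval_shift. Qed.

Lemma corr_formC p q : corr_form p q = corr_form q p.
Proof. by congr (L _); apply/funext => x /=; rewrite mulrC. Qed.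

Lemma corr_formD p q r : corr_form (p + q) r = corr_form p r + corr_form q r.
Proof.
rewrite /corr_form -(meanD Lm) //; congr (L _); apply/funext => x /=.
by rewrite eval_shiftD mulrDl.
Qed.

Lemma corr_formZ c p r : corr_form (c *: p) r = c * corr_form p r.
Proof.
rewrite /corr_form -(meanZ Lm) //; congr (L _); apply/funext => x /=.
by rewrite eval_shiftZ mulrA.
Qed.

Lemma corr_form_ge0 p : 0 <= corr_form p p.
Proof. by apply: (mean_ge0 Lm) => // x; rewrite /= -expr2 sqr_ge0. Qed.

Lemma corr_formX p q : corr_form ('X * p) ('X * q) = corr_form p q.
Proof.
rewrite /corr_form -[RHS](mean_shift Lm) //; congr (L _); apply/funext => x /=.
by rewrite !eval_shiftX.
Qed.

Lemma mean_le f g : bounded_fun f -> bounded_fun g -> (forall x, f x <= g x) ->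
  L f <= L g.
Proof.
move=> bf bg fg; have bNf : bounded_fun (fun x => -1 * f x).
  by have [C fC] := bf; exists C => x; rewrite mulN1r normrN.
rewrite -subr_ge0 -mulN1r -(meanZ Lm) // addrC addrC -(meanD Lm) //.
apply: (mean_ge0 Lm); first exact: bounded_funD.
by move=> x /=; rewrite mulN1r subr_ge0.
Qed.

Lemma mean_cst c : L (fun=> c) = c.
Proof.
rewrite -[RHS]mulr1 -(mean1 Lm) -(meanZ Lm); last exact: bounded_cst.
by congr (L _); apply/funext => x; rewrite mulr1.
Qed.

Lemma corr_form11 : corr_form 1 1 <= 1.
Proof.
rewrite -[leRHS](mean1 Lm); apply: mean_le => //; first exact: bounded_cst.
move=> x; rewrite /= -(expr0 'X) eval_shiftXn.
by have /andP[v0 v1] := v01 (x + 0%:Z); rewrite mulr_ile1.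
Qed.

Lemma mean_eval_shift p : L (eval_shift p) = p.[1] * L v.
Proof.
elim/poly_ind: p => [|p c IH].
  rewrite horner0 mul0r -(mean_cst 0); congr (L _); apply/funext => x.
  by rewrite /eval_shift size_poly0 big_ord0.
have -> : eval_shift (p * 'X + c%:P) = (fun x => eval_shift p (x + 1)) \+ (fun x => c * v x).
  apply/funext => x /=; rewrite eval_shiftD mulrC eval_shiftX; congr (_ + _).
  by rewrite -[c%:P]mulr1 mul_polyC eval_shiftZ -(expr0 'X) eval_shiftXn addr0.
have bv : bounded_fun v.
  by exists 1 => x; have /andP[v0 v1] := v01 x; rewrite ger0_norm.
have bp := bounded_eval_shift p.
rewrite (meanD Lm); first last.
- by have [C vC] := bv; exists (`|c| * C) => x; rewrite normrM ler_wpM2l.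
- by have [C pC] := bp; exists C.
by rewrite (mean_shift Lm) // (meanZ Lm) // IH hornerMXaddC mulr1 mulrDl.
Qed.

(** The variance [L ((f - L f) ^ 2)] of [f = eval_shift p] is nonnegative, and [L f = p.[1] L v]. *)
Lemma corr_form_ge p : (L v * p.[1]) ^+ 2 <= corr_form p p.
Proof.
rewrite mulrC -mean_eval_shift; set c := L _.
have bp := bounded_eval_shift p.
have bcp : bounded_fun (fun x => (- 2 * c) * eval_shift p x).
  by have [C pC] := bp; exists (`|- 2 * c| * C) => x; rewrite normrM ler_wpM2l.
have : 0 <= L ((eval_shift p \* eval_shift p) \+
    ((fun x => (- 2 * c) * eval_shift p x) \+ (fun=> c ^+ 2))).
  apply: (mean_ge0 Lm).
    apply: bounded_funD => //; apply: bounded_funD => //; exact: bounded_cst.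
  move=> x /=; rewrite (_ : _ + _ = (eval_shift p x - c) ^+ 2) ?sqr_ge0 //; ring.
rewrite (meanD Lm) //; last by apply: bounded_funD => //; apply: bounded_cst.
rewrite (meanD Lm) //; last exact: bounded_cst.
by rewrite (meanZ Lm) // mean_cst -/c -/(corr_form p p); lra.
Qed.

Lemma corr_form_support n : 0 < corr_form 'X^n 1 ->
  exists x, v (x + n%:Z) != 0 /\ v x != 0.
Proof.
move=> pos; apply: contrapT => /forallNP none; move: pos.
rewrite /corr_form (_ : _ \* _ = fun=> 0) ?mean_cst ?ltxx //.
apply/funext => x /=; rewrite -(expr0 'X) !eval_shiftXn addr0.
have [->|vn] := eqVneq (v (x + n%:Z)) 0; first by rewrite mul0r.
have [->|vx] := eqVneq (v x) 0; first by rewrite mulr0.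
by case: (none x).
Qed.

End CorrelationForm.

End InvariantMean.

(** * Polynomial sequences among the values of the power sum *)

Section PowerSequences.
Local Open Scope ring_scope.

(** Each nonconstant binomial term carries a factor [M], and the bound on [c] makes the constant
    term natural, so [absz] changes no value. *)
Lemma poly_seq_power (M n A : nat) (c : int) : (0 < n)%N -> (0 < M)%N ->
  0 <= (A ^ n)%N%:Z + c ->
  poly_seq M n (fun y => absz (((A + M * y) ^ n)%N%:Z + c)).
Proof.
move=> n0 M0 Ac.
exists (fun i => if i == 0%N then absz ((A ^ n)%N%:Z + c)%R
                 else 'C(n, i) * (A ^ (n - i) * M ^ i))%N.
split=> [|i i0|y].
- by rewrite (gtn_eqF n0) binn subnn !mul1n expn_gt0 M0.
- by rewrite (gtn_eqF i0) !dvdn_mull // -(prednK i0) expnS dvdn_mulr.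
rewrite expnDn big_ord_recl [in RHS]big_ord_recl /= bin0 subn0 mul1n !muln1.
rewrite [in RHS](eq_bigr (fun i : 'I_n =>
  'C(n, bump 0 i) * (A ^ (n - bump 0 i) * (M * y) ^ bump 0 i))%N).
  by move: (\sum_(i < n) _)%N Ac => S; lia.
by move=> i _; rewrite expnMn !mulnA.
Qed.

Lemma power_sum_poly_seq l n k M : (0 < l)%N -> (0 < n)%N -> (0 < M)%N ->
  solvable_modulus l n k M -> exists g : nat -> nat,
  [/\ poly_seq M n g, forall y, (M %| g y)%N, forall y, (0 < g y)%N &
      forall y, exists x : 'I_l -> int, \sum_i x i ^+ n - k = (g y)%:Z].
Proof.
move=> l0 n0 M0 [x hx]; pose i := Ordinal l0.
set c := \sum_j x j ^+ n - x i ^+ n - k.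
(* [A] is congruent to [x i] modulo [M], which keeps the values divisible by [M], and so large that
   every value is positive, hence a nonzero difference later. *)
pose b := (`|x i| + `|c| + 1)%N; pose A := absz (x i + (M * b)%N%:Z).
have AE : A%:Z = x i + (M * b)%N%:Z.
  have : (b <= M * b)%N by rewrite leq_pmull.
  rewrite /A /b; lia.
have cA : (`|c| < A)%N.
  have : (b <= M * b)%N by rewrite leq_pmull.
  by move: AE; rewrite /b; lia.
have An y : (`|c| < (A + M * y) ^ n)%N.
  apply: (leq_trans cA (leq_trans (leq_addr (M * y) A) _)).
  case: (n) n0 => // n' _; rewrite expnS leq_pmulr // expn_gt0 addn_gt0.
  by rewrite (leq_ltn_trans (leq0n _) cA).
have gE y : (absz (((A + M * y) ^ n)%N%:Z + c))%:Z = ((A + M * y) ^ n)%N%:Z + c.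
  by have := An y; lia.
have pE y : ((A + M * y) ^ n)%N%:Z = (x i + (M * (b + y))%N%:Z) ^+ n.
  rewrite -[LHS]natz natrX natz; congr (_ ^+ _).
  by rewrite PoszD AE mulnDr PoszD addrA.
exists (fun y => absz (((A + M * y) ^ n)%N%:Z + c)); split=> [|y|y|y].
- apply: poly_seq_power => //; have := An 0%N; rewrite muln0 addn0; lia.
- rewrite -[X in (X %| _)%N]/(`|M%:Z|%N) -dvdzE pE.
  rewrite (_ : _ + c = (\sum_j x j ^+ n - k) + ((x i + (M * (b + y))%N%:Z) ^+ n - x i ^+ n)).
    by rewrite rpredD // subrXX dvdz_mulr // addrC addKr PoszM dvdz_mulr.
  by rewrite /c; ring.
- by have := An y; lia.
exists (fun j => if j == i then (A + M * y)%N%:Z else x j).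
rewrite sum_update_power gE -[in RHS]natz natrX natz /c; ring.
Qed.

End PowerSequences.

(** * Upper density and intersectivity *)

Section Density.
Local Open Scope classical_set_scope.
Local Open Scope ring_scope.
Variable R : realType.
Implicit Types (T : set int) (m : nat).

Definition window_density T m : R :=
  (#|` fset_set (T `&` window m) |%fset)%:R / (2 * m + 1)%:R.

Definition indicator T (x : int) : R := (x \in T)%:R.

Lemma window_densityE T m : window_density T m = window_mean (indicator T) m.
Proof.
rewrite /window_density /window_mean mulrC; congr (_ * _).
set s := [seq x <- [seq (j : nat)%:Z - m%:Z | j <- iota 0 (2 * m + 1)] | x \in T].
have -> : #|` fset_set (T `&` window m)|%fset = size s.
  apply/perm_size/uniq_perm; first exact: fset_uniq.
    by rewrite filter_uniq // map_inj_uniq ?iota_uniq // => i j; lia.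
  move=> x; rewrite in_fset_set; last exact: finite_setIr (finite_window m).
  rewrite mem_filter in_setI; congr (_ && _).
  apply/idP/idP; rewrite inE /window /=.
    move=> /andP[h1 h2]; apply/mapP; exists (absz (x + m%:Z)); last by lia.
    by rewrite mem_iota; lia.
  by move=> /mapP[j]; rewrite mem_iota => /andP[_ h] ->; lia.
rewrite size_filter -sum1_count natr_sum big_map big_mkcond /=.
rewrite -(big_mkord xpredT (fun j => indicator T (j%:Z - m%:Z))) /index_iota subn0.
by apply: eq_bigr => j _; rewrite /indicator; case: (_ \in T).
Qed.

Lemma upper_density_pos T : (0 < upper_density R T)%E ->
  exists2 d : R, 0 < d & forall n, exists2 m, (n <= m)%N & d <= window_density T m.
Proof.
move=> pos; have [d d0 hd] : exists2 d : R, 0 < d & (d%:E < upper_density R T)%E.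
  move: pos; case: (upper_density R T) => [r| |] //.
    by rewrite lte_fin => r0; exists (r / 2); rewrite ?lte_fin; lra.
  by move=> _; exists 1; rewrite ?ltry.
exists d => // n.
have : (d%:E < ereal_sup ((fun m => (window_density T m)%:E) @` [set m | (n <= m)%N]))%E.
  apply: lt_le_trans hd _; apply: ereal_inf_lbound; exists [set m | (n <= m)%N] => //.
  by exists n.
by move=> /ereal_sup_gt[_ [m nm <-]]; rewrite lte_fin => /ltW h; exists m.
Qed.

(** The window of radius [N n] contains the [n + 1] multiples [0, N, ..., N n], a proportion of at
    least [1 / (2 N)]. *)
Lemma upper_density_multiples (N : nat) : (0 < N)%N ->
  (0 < upper_density R [set i | (N%:Z %| i)%Z])%E.
Proof.
move=> N0; set T := [set i | _].
have N2 : 0 < (2 * N)%:R :> R by rewrite ltr0n muln_gt0.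
apply: (@lt_le_trans _ _ ((2 * N)%:R^-1%:E)); first by rewrite lte_fin invr_gt0.
apply: le_ereal_inf_tmp => _ [V [n _ nV] <-].
apply: le_trans (_ : (window_density T (N * n))%:E <= _)%E; last first.
  apply: ereal_sup_ubound; exists (N * n)%N => //.
  by apply: nV; rewrite /= leq_pmull.
have card_ge : (n.+1 <= #|` fset_set (T `&` window (N * n)) |%fset)%N.
  pose s := [seq (N * i)%N%:Z | i <- iota 0 n.+1].
  have <- : size s = n.+1 by rewrite size_map size_iota.
  apply: uniq_leq_size.
    rewrite map_inj_uniq ?iota_uniq // => i j [] /eqP.
    by rewrite eqn_pmul2l // => /eqP.
  move=> x /mapP[i]; rewrite mem_iota => /andP[_ lin] ->.
  rewrite in_fset_set; last exact: finite_setIr (finite_window _).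
  rewrite inE; split; first by rewrite /T /= PoszM dvdz_mulr.
  rewrite /window /=; apply/andP; split; first by lia.
  by rewrite lez_nat leq_mul.
rewrite lee_fin /window_density ler_pdivlMr ?ltr0n ?addn1 //.
rewrite mulrC ler_pdivrMr // -natrM ler_nat.
apply: leq_trans (_ : n.+1 * (2 * N) <= _)%N; last by rewrite leq_mul2r card_ge orbT.
by nia.
Qed.

(** The test set is the multiples of [N]: a value of [f] in its difference set solves the
    congruence, and without one the intersection is empty. *)
Lemma intersective_solvable_mod l (f : mpoly.mpoly l int) (N : nat) : (0 < N)%N ->
  intersective_poly R f -> solvable_mod f N.
Proof.
move=> N0 int_f; apply: contrapT => nsol.
apply: (int_f _ (upper_density_multiples N0)) => _ [[x _ <-] [t Nt [t' Nt' fx]]].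
case: nsol; exists x; apply/eqP.
by rewrite eqz_mod_dvd subr0 -fx rpredB.
Qed.

Lemma solvable_modulus_intersective l n k (f : mpoly.mpoly l int) :
  (0 < l)%N -> (0 < n)%N ->
  (forall x, mpoly.meval x f = \sum_i x i ^+ n - k) ->
  (forall M, (0 < M)%N -> solvable_modulus l n k M) -> intersective_poly R f.
Proof.
move=> l0 n0 fE sol T /upper_density_pos[d d0 dens] sub.
have [L Lm Lge] := invariant_mean_exists R dens.
pose v := indicator T.
have v01 x : 0 <= v x <= 1 by rewrite /v /indicator; case: (_ \in T); rewrite ?lexx ?ler01.
have dL : d <= L v.
  apply: Lge; first by exists 1 => x; have /andP[v0 v1] := v01 x; rewrite ger0_norm.
  by move=> m; rewrite -window_densityE.
have L0 : 0 < L v by apply: lt_le_trans dL.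
have [M M0 hM] := @positive_correlation R (corr_form L v) (corr_formC L v)
  (corr_formD Lm v01) (corr_formZ Lm v01) (corr_form_ge0 Lm v01) (corr_formX Lm v01)
  n.-1 (L v) L0 (corr_form11 Lm v01) (corr_form_ge Lm v01).
have [g [pg Mg g0 gval]] := power_sum_poly_seq l0 n0 M0 (sol M M0).
have [|y /(corr_form_support Lm)[t [vt' vt]]] := hM g _ Mg.
  by rewrite prednK.
have mem_v z : v z != 0 -> T z.
  by rewrite /v /indicator; case: (boolP (z \in T)) => [/[!inE] //|]; rewrite eqxx.
have [x hx] := gval y.
have : [set 0] ((g y)%:Z : int).
  apply: sub; split; first by exists x => //; rewrite fE.
  exists (t + (g y)%:Z); first exact: mem_v.
  by exists t; [exact: mem_v | rewrite addrC addKr].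
by move=> /= e; have := g0 y; lia.
Qed.

End Density.

(** * The congruence conditions and the final equivalence *)

Section LocalConditions.
Local Open Scope ring_scope.

Lemma solvable_modulus_dvd l n k (M N : nat) : (M %| N)%N ->
  solvable_modulus l n k N -> solvable_modulus l n k M.
Proof. by move=> MN [x hx]; exists x; apply: dvdz_trans hx; rewrite dvdzE. Qed.

Lemma solvable_modulus_prime l n k q : prime q -> odd n -> (1 < n)%N ->
  n.+1 = (2 * l)%N -> q <> (2 * n + 1)%N -> solvable_modulus l n k q.
Proof.
move=> q_pr on n1 nl nq.
have [x hx] := every_residue_power_sum q_pr on n1 (k%:~R : 'F_q) nl nq.
exists (fun i => (x i : nat)%:Z); rewrite (dvdz_pcharf (pchar_Fp q_pr)).
rewrite rmorphB rmorph_sum /= -hx subr_eq0; apply/eqP; apply: eq_bigr => i _.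
by rewrite rmorphXn /= -pmulrn natr_Zp.
Qed.

(** Lifting and gluing reduce to the moduli [q ^ (logn q n).+1]; for [q] not dividing [n] this is
    [q] itself, settled in the prime field unless [q = 2 n + 1]. *)
Lemma solvable_modulus_all l n k : odd n -> (1 < n)%N -> n.+1 = (2 * l)%N ->
  (forall q, prime q -> (q %| n)%N -> solvable_modulus l n k (q ^ (logn q n).+1)) ->
  (prime (2 * n + 1) -> solvable_modulus l n k (2 * n + 1)) ->
  forall M, (0 < M)%N -> solvable_modulus l n k M.
Proof.
move=> on n1 nl hn hp; apply: power_sum_local_global => q e q_pr.
have [x hx] : solvable_modulus l n k (q ^ (logn q n).+1).
  have [qn|qn] := boolP (q %| n)%N; first exact: hn.
  have -> : logn q n = 0%N.
    by apply/eqP; rewrite -leqn0 leqNgt logn_gt0 mem_primes (negPf qn) !andbF.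
  rewrite expn1; have [q2|/eqP q2] := eqVneq q (2 * n + 1)%N; last exact: solvable_modulus_prime.
  by rewrite q2; apply: hp; rewrite -q2.
by apply: (@power_sum_prime_power l n q e k x) => //; lia.
Qed.

End LocalConditions.

Theorem theorem5p5 (R : realType) (n : nat) (hn1 : (1 < n)%N) (hodd : odd n)
    (k : int) (t : nat) (p a : 'I_t -> nat)
    (hinj : injective p) (hprime : forall i : 'I_t, prime (p i))
    (ha : forall i : 'I_t, (1 <= a i)%N)
    (hfact : n = (\prod_(i < t) p i ^ a i)%N) :
  let N := (\prod_(i < t) p i ^ (a i).+1)%N in
  intersective_poly R (power_sum_poly n k) <->
    (~~ prime (2 * n + 1) -> solvable_mod (power_sum_poly n k) N) /\
    (prime (2 * n + 1) ->
      solvable_mod (power_sum_poly n k) ((2 * n + 1) * N)).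
Proof.
move=> N; have N0 : (0 < N)%N.
  by apply: prodn_gt0 => i; rewrite expn_gt0 prime_gt0.
have nl : n.+1 = (2 * num_vars n)%N.
  have := odd_double_half n; have := uphalf_half n; rewrite /num_vars /= hodd; lia.
split=> [int_f|[h1 h2]].
  split=> _; apply: (@intersective_solvable_mod R) => //.
  by rewrite muln_gt0 N0 addn1.
have solE M : solvable_mod (power_sum_poly n k) M -> solvable_modulus (num_vars n) n k M.
  move=> [x /eqP hx]; exists x; move: hx.
  by rewrite eqz_mod_dvd subr0 meval_power_sum_poly.
have solN : solvable_modulus (num_vars n) n k N.
  have [/h2/solE|/h1/solE //] := boolP (prime (2 * n + 1)).
  by apply: solvable_modulus_dvd; rewrite dvdn_mull.
apply: (@solvable_modulus_intersective R _ n k); [lia|lia|exact: meval_power_sum_poly|].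
apply: solvable_modulus_all => // [q q_pr qn|p2n]; last first.
  by apply: solvable_modulus_dvd (solE _ (h2 p2n)); rewrite dvdn_mulr.
apply: solvable_modulus_dvd solN.
(* [N] contains one more factor [q] than [n] does, which is the precision Hensel lifting starts
   from. *)
have NE : N = (n * \prod_(i < t) p i)%N.
  by rewrite [in RHS]hfact -big_split /=; apply: eq_bigr => i _; rewrite expnSr.
rewrite NE expnSr dvdn_mul ?pfactor_dvdnn //.
move: qn; rewrite hfact Euclid_dvd_prod // big_orE => /existsP[i /= ].
rewrite Euclid_dvdX // => /andP[qi _].
by rewrite (bigD1 i) //= dvdn_mulr.
Qed.
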